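(* \[m_{\mathbb{H}}(1+x+y)=\frac12-\frac{11\sqrt3}{16\pi}+\frac{3\sqrt3}{4\pi}L(\chi_{-3},2).\]
   Context: $\mathbb{H}$ denotes the quaternions, $\mathbb{T}^2(\mathbb{H})=\{(x,y)\in\mathbb{H}^2:|x|=|y|=1\}$ with probability Haar measure $\mu$ (product of normalized surface measures on $S^3$), and $m_{\mathbb{H}}(P)=\int_{\mathbb{T}^2(\mathbb{H})}\log|P(x,y)|\,d\mu$. $L(\chi_{-3},s)=\sum_{n\ge1}\chi_{-3}(n)n^{-s}$ where $\chi_{-3}$ is the odd Dirichlet character of conductor 3. *)

(* Defs.v *)
From HB Require Import structures.
From mathcomp Require Import all_boot all_order all_algebra.
From mathcomp Require Import all_classical all_reals all_analysis.
Set Implicit Arguments. Unset Strict Implicit. Unset Printing Implicit Defensive.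
Import Order.TTheory GRing.Theory Num.Theory.
Import numFieldNormedType.Exports.
Local Open Scope classical_set_scope.
Local Open Scope ring_scope.

Section Defs.
Context (R : realType).

(* The quaternions H, as a real vector space: q = a + b i + c j + d k is
   represented by ((a, b), (c, d)).  Only the additive structure, the unit 1
   and the modulus are needed for the polynomial 1 + x + y. *)
Definition quat := ((R * R) * (R * R))%type.

Definition qadd (p q : quat) : quat :=
  ((p.1.1 + q.1.1, p.1.2 + q.1.2), (p.2.1 + q.2.1, p.2.2 + q.2.2)).
Definition qone : quat := ((1, 0), (0, 0)).
Definition qscale (t : R) (q : quat) : quat :=
  ((t * q.1.1, t * q.1.2), (t * q.2.1, t * q.2.2)).
Definition qnorm (q : quat) : R :=
  Num.sqrt (q.1.1 ^+ 2 + q.1.2 ^+ 2 + q.2.1 ^+ 2 + q.2.2 ^+ 2).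

Definition S3 : set quat := [set q | qnorm q = 1].
Definition B4 : set quat := [set q | qnorm q <= 1].

Definition leb4 : set quat -> \bar R :=
  ((@lebesgue_measure R \x @lebesgue_measure R) \x
   (@lebesgue_measure R \x @lebesgue_measure R))%E.

(* Normalized surface (Haar) measure on S^3, defined as the normalized cone
   measure: sigma(A) = leb4 {t u | 0 < t <= 1, u in A /\ S^3} / leb4(B4),
   i.e. the pushforward of normalized Lebesgue measure on the unit ball under
   the radial projection u |-> u/|u|. *)
Definition cone (A : set quat) : set quat :=
  [set u | 0 < qnorm u <= 1 /\ (A `&` S3) (qscale (qnorm u)^-1 u)].
Definition sigma3 (A : set quat) : \bar R :=
  ((fine (leb4 B4))^-1)%:E * leb4 (cone A).

Definition muT2 : set (quat * quat) -> \bar R := (sigma3 \x sigma3)%E.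

Definition logabs (q : quat) : \bar R :=
  if qnorm q == 0 then -oo%E else (ln (qnorm q))%:E.

Definition mH (P : quat -> quat -> quat) : \bar R :=
  (\int[muT2]_(z in [set z : quat * quat | S3 z.1 /\ S3 z.2]) logabs (P z.1 z.2))%E.

Definition chi3 (n : nat) : R :=
  if (n %% 3 == 1)%N then 1 else if (n %% 3 == 2)%N then -1 else 0.

Definition Lchi3_2 : R :=
  limn (fun N => \sum_(1 <= n < N) (chi3 n / (n%:R ^+ 2))).

End Defs.

(* Main.v *)
(* For fixed [x] put [a = 1 + x]. By rotation invariance the mean over [y] of
   [log |a + y|] only depends on [r = |a|], and the real part [cos t] of a point of
   [S^3] has law [2 / pi * sin t ^ 2 dt]. Expanding [log |r + exp (i t)|] in the
   cosine series [sum (-1)^(n+1) r^n cos (n t) / n], whose terms other than [n = 2]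
   are orthogonal to [sin t ^ 2], gives the mean [r^2 / 4] if [r < 1] and
   [log r + 1 / (4 r^2)] if [r > 1]. Since [|1 + x| = 2 cos (t / 2)] for [x] of
   real part [cos t], the two regimes meet at [t = 2 pi / 3]; everything is
   elementary except the integral of [log (2 cos (t / 2))] over [[0, 2 pi / 3]],
   whose cosine series at [2 pi / 3] sums to [3 sqrt 3 / 4 * L(chi_{-3}, 2)].
   To stay within nonnegative integrands, Tonelli is applied to
   [log 3 - log |1 + x + y|]. *)
Require Import Defs.
From HB Require Import structures.
From mathcomp Require Import all_boot all_order all_algebra.
From mathcomp Require Import all_classical all_reals all_analysis.
From mathcomp Require Import measurable_realfun ring lra.
Set Implicit Arguments. Unset Strict Implicit. Unset Printing Implicit Defensive.
Import Order.TTheory GRing.Theory Num.Theory.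
Import numFieldNormedType.Exports.
Local Open Scope classical_set_scope.
Local Open Scope ring_scope.

(** Polar coordinates in dimension four are avoided. The surface measure is the radial projection of
    Lebesgue measure on the ball, so it inherits its rotation invariance from plane Lebesgue
    measure, where a rotation is a product of three shears; plane rotations then line [1 + x] up
    with the real axis. The law of the real part comes from slicing the ball along that axis and
    scaling each slice. The radial integral left over is an unknown constant, identified by applying
    the slicing formula to the ball itself, so the volume of the ball is never evaluated.

    One-dimensional integrals are handled as increments of antiderivatives, and series are compared
    with them through bounds on derivatives. The cosine series is controlled only where
    [1 + r ^+ 2 + 2 * r * cos t] stays away from zero, which fails for [r = 1] near [t = pi]. Hence
    [|1 + x| = 1] is excluded from the inner mean, as a null set of [x]; the outer integral does use
    [r = 1], but only on the arc up to [2 * pi / 3]. The constant [3] is the maximum of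
    [|1 + x + y|]. *)

Section Affine.
Context (R : realType).
Notation mu := (@lebesgue_measure R).
Notation mR := (measurableTypeR R).

Lemma measurable_affine (k a : R) :
  measurable_fun setT ((fun x => k * x + a) : mR -> mR).
Proof.
apply: measurable_funD => //; exact: measurable_funM.
Qed.

Lemma preimage_affine_oc (k a u v : R) : 0 < k ->
  (fun x => k * x + a) @^-1` `]u, v] = `](u - a) / k, (v - a) / k]%classic.
Proof.
move=> k0; apply/seteqP; split=> x /=; rewrite !in_itv/=;
  by rewrite ltr_pdivrMr// ler_pdivlMr// ltrBlDr lerBrDr mulrC.
Qed.

Definition pushforward_measure d d' (T1 : measurableType d) (T2 : measurableType d')
    (m : {measure set T1 -> \bar R}) (f : T1 -> T2)
    (mf : measurable_fun setT f) : {measure set T2 -> \bar R} :=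
  measure_function_pushforward__canonical__measure_function_Measure m mf.

(** Both sides are measures in [A], and Lebesgue measure is determined by its values on the
    half-open intervals []u, v]], where only lengths have to be compared. *)
Lemma lebesgue_measure_affine (k a : R) (A : set R) : 0 < k -> measurable A ->
  mu A = (k%:E * mu ((fun x => k * x + a)%R @^-1` A))%E.
Proof.
move=> k0 mA.
pose nu := mscale (NngNum (ltW k0)) (pushforward_measure mu (measurable_affine k a)).
rewrite (@lebesgue_measure_unique R nu)// => _ [[u v]] _ <- /=.
rewrite /nu /mscale /pushforward_measure /= /pushforward /= preimage_affine_oc//.
rewrite !lebesgue_measure_itv/= !lte_fin ltr_pM2r ?invr_gt0// ltrD2r.
case: ifPn => _; last by rewrite mule0.
by rewrite -!EFinB -EFinM; congr EFin; field; rewrite gt_eqF.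
Qed.

Lemma ge0_integral_affine (k a : R) (f : R -> \bar R) : 0 < k ->
  measurable_fun setT f -> (forall x, 0 <= f x)%E ->
  (\int[mu]_x f x = k%:E * \int[mu]_x f (k * x + a)%R)%E.
Proof.
move=> k0 mf f0.
transitivity (\int[mscale (NngNum (ltW k0)) (pushforward_measure mu (measurable_affine k a))]_x f x)%E.
  by apply: eq_measure_integral => A mA _; exact: lebesgue_measure_affine.
rewrite ge0_integral_mscale//= ge0_integral_pushforward//.
exact: measurable_affine.
Qed.

End Affine.

(** * Sigma-finite products and Tonelli *)

Section ProductMeasure.
Context d1 d2 (T1 : measurableType d1) (T2 : measurableType d2) (R : realType).
Variables (m1 : {sigma_finite_measure set T1 -> \bar R})
  (m2 : {sigma_finite_measure set T2 -> \bar R}).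
Local Open Scope ereal_scope.

Lemma product_sigma_finite : sigma_finite setT (m1 \x m2).
Proof.
have /sigma_finiteP[F [TF ndF Foo]] := sigma_finiteT m1.
have /sigma_finiteP[G [TG ndG Goo]] := sigma_finiteT m2.
exists (fun n => F n `*` G n).
  rewrite -setXTT TF TG predeqE => -[x y]; split.
    move=> [/= [n _ Fnx] [k _ Gky]]; exists (maxn n k) => //; split.
    - by move: x Fnx; exact/subsetPset/ndF/leq_maxl.
    - by move: y Gky; exact/subsetPset/ndG/leq_maxr.
  by move=> [n _ []/= ? ?]; split; exists n.
move=> k; have [? ?] := Foo k; have [? ?] := Goo k.
split; first exact: measurableX.
by rewrite product_measure1E// lte_mul_pinfty// ge0_fin_numE.
Qed.
(* The library's canonical sigma-finite structure on a product of measures only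
   fires for products of subprobabilities, hence this explicit one. *)
Definition sigma_finite_prod : {sigma_finite_measure set (T1 * T2)%type -> \bar R} :=
  HB.pack (m1 \x m2) (Measure_isSigmaFinite.Build _ _ _ (m1 \x m2)
    product_sigma_finite).

Lemma tonelli1 (f : T1 * T2 -> \bar R) : measurable_fun setT f ->
  (forall z, 0 <= f z) ->
  \int[sigma_finite_prod]_z f z = \int[m1]_x \int[m2]_y f (x, y).
Proof. exact: fubini_tonelli1. Qed.

Lemma tonelli2 (f : T1 * T2 -> \bar R) : measurable_fun setT f ->
  (forall z, 0 <= f z) ->
  \int[sigma_finite_prod]_z f z = \int[m2]_y \int[m1]_x f (x, y).
Proof. exact: fubini_tonelli2. Qed.

End ProductMeasure.
Arguments tonelli1 {d1 d2 T1 T2 R m1 m2} f.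
Arguments tonelli2 {d1 d2 T1 T2 R m1 m2} f.

(** * Measure-preserving maps of product spaces *)

Section Preserving.
Context (R : realType).
Local Open Scope ereal_scope.

(** Invariance is phrased on nonnegative integrals rather than on sets, the form in which it
    composes and passes through Tonelli one factor at a time. *)
Definition preserves d (T : measurableType d) (m : set T -> \bar R) (f : T -> T) :=
  measurable_fun setT f /\
  forall g : T -> \bar R, measurable_fun setT g -> (forall x, 0 <= g x) ->
    \int[m]_x g (f x) = \int[m]_x g x.

Lemma preserves_comp d (T : measurableType d) (m : set T -> \bar R) (f1 f2 : T -> T) :
  preserves m f1 -> preserves m f2 -> preserves m (f1 \o f2).
Proof.
move=> [m1 h1] [m2 h2]; split; first exact: measurableT_comp.
move=> g mg g0; rewrite -[RHS]h1//; apply: (h2 (g \o f1)) => [|x]; last exact: g0.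
exact: measurableT_comp.
Qed.

Section product.
Context d1 d2 (T1 : measurableType d1) (T2 : measurableType d2).
Variables (m1 : {sigma_finite_measure set T1 -> \bar R})
  (m2 : {sigma_finite_measure set T2 -> \bar R}).

Lemma preserves_left (f : T1 -> T1) : preserves m1 f ->
  preserves (sigma_finite_prod m1 m2) (fun z => (f z.1, z.2)).
Proof.
move=> [mf hf].
have mF : measurable_fun setT (fun z : T1 * T2 => (f z.1, z.2)).
  by apply: measurable_fun_pair => //; exact: measurableT_comp.
split=> // g mg g0.
rewrite (tonelli2 (g \o _) (measurableT_comp mg mF) (fun=> g0 _))/=.
rewrite tonelli2//; apply: eq_integral => y _.
rewrite /= (hf (fun x => g (x, y)))//.
exact: measurableT_comp.
Qed.

Lemma preserves_right (f : T2 -> T2) : preserves m2 f ->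
  preserves (sigma_finite_prod m1 m2) (fun z => (z.1, f z.2)).
Proof.
move=> [mf hf].
have mF : measurable_fun setT (fun z : T1 * T2 => (z.1, f z.2)).
  by apply: measurable_fun_pair => //; exact: measurableT_comp.
split=> // g mg g0.
rewrite (tonelli1 (g \o _) (measurableT_comp mg mF) (fun=> g0 _))/=.
rewrite tonelli1//; apply: eq_integral => x _.
rewrite /= (hf (fun y => g (x, y)))//.
exact: measurableT_comp.
Qed.

End product.

Lemma preserves_swap d (T : measurableType d)
    (m : {sigma_finite_measure set T -> \bar R}) :
  preserves (sigma_finite_prod m m) (fun z => (z.2, z.1)).
Proof.
have mF : measurable_fun setT (fun z : T * T => (z.2, z.1)).
  exact: measurable_fun_pair.
split=> // g mg g0.
rewrite (tonelli2 (g \o _) (measurableT_comp mg mF) (fun=> g0 _))/=.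
by rewrite tonelli1.
Qed.

(** In iterated integrals this exchanges the two middle variables, which is Tonelli with the outer
    variable fixed. Conjugation by this map turns a rotation of the first two coordinates into one
    of the first and third. *)
Lemma preserves_middle d (T : measurableType d)
    (m : {sigma_finite_measure set T -> \bar R}) :
  preserves (sigma_finite_prod (sigma_finite_prod m m) (sigma_finite_prod m m)) (fun z => ((z.1.1, z.2.1), (z.1.2, z.2.2))).
Proof.
have mF : measurable_fun setT
    (fun z : (T * T) * (T * T) => ((z.1.1, z.2.1), (z.1.2, z.2.2))).
  by apply: measurable_fun_pair; apply: measurable_fun_pair;
    exact: measurableT_comp.
split=> // g mg g0.
have E (h : (T * T) * (T * T) -> \bar R) : measurable_fun setT h ->
    (forall z, 0 <= h z) ->
    \int[sigma_finite_prod (sigma_finite_prod m m) (sigma_finite_prod m m)]_z h z =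
    \int[m]_a \int[m]_b \int[m]_c \int[m]_d h ((a, b), (c, d)).
  move=> mh h0; rewrite (tonelli1 h mh h0).
  have mF1 : measurable_fun setT (fun ab => \int[sigma_finite_prod m m]_cd h (ab, cd)).
    exact: (measurable_fun_fubini_tonelli_F (m2 := sigma_finite_prod m m) h mh h0).
  have F0 ab : 0 <= \int[sigma_finite_prod m m]_cd h (ab, cd) by exact: integral_ge0.
  rewrite (tonelli1 _ mF1 F0).
  apply: eq_integral => a _; apply: eq_integral => b _.
  have mh1 : measurable_fun setT (fun cd => h ((a, b), cd)).
    exact: measurableT_comp.
  by rewrite (tonelli1 _ mh1 (fun=> h0 _)).
rewrite (E (g \o _) (measurableT_comp mg mF) (fun=> g0 _)).
rewrite (E g mg g0); apply: eq_integral => a _ /=.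
pose k (p : (T * T) * T) := g ((a, p.1.2), (p.1.1, p.2)).
have mk : measurable_fun setT k.
  apply: measurableT_comp => //; apply: measurable_fun_pair;
    apply: measurable_fun_pair => //; exact: measurableT_comp.
have k0 p : 0 <= k p by exact: g0.
have mK := measurable_fun_fubini_tonelli_F (m2 := m) k mk k0.
have K0 p : 0 <= \int[m]_d k (p, d) by exact: integral_ge0.
exact: (fubini_tonelli (fun p => \int[m]_d k (p, d)) mK K0).
Qed.

End Preserving.

(** * Plane rotations as products of shears *)

Section Rotation.
Context (R : realType).
Notation mu := (@lebesgue_measure R).
Notation mR := (measurableTypeR R).
Notation leb2 := (sigma_finite_prod mu mu).

Lemma preserves_shear (t : R) :
  preserves leb2 (fun z : mR * mR => (z.1 + t * z.2, z.2)).
Proof.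
have mF : measurable_fun setT (fun z : mR * mR => (z.1 + t * z.2, z.2)).
  apply: measurable_fun_pair => //; apply: measurable_funD => //.
  exact: measurable_funM.
split=> // g mg g0.
rewrite (tonelli2 (g \o _) (measurableT_comp mg mF) (fun=> g0 _))/=.
rewrite tonelli2//; apply: eq_integral => y _.
rewrite /= [RHS](ge0_integral_affine (t * y) (@ltr01 R))//; last first.
  exact: measurableT_comp.
by rewrite mul1e; under [RHS]eq_integral do rewrite mul1r.
Qed.

(** A rotation by [theta] is a horizontal, a vertical and a horizontal shear. The horizontal
    coefficient is [- tan (theta / 2)], that is [- (s / (1 + c))]; the vertical shear is a
    horizontal one conjugated by the swap. The condition [0 <= c] keeps [1 + c] away from zero. *)
Lemma preserves_rotation (c s : R) : 0 <= c -> c ^+ 2 + s ^+ 2 = 1 ->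
  preserves leb2 (fun z : mR * mR => (c * z.1 - s * z.2, s * z.1 + c * z.2)).
Proof.
move=> c0 cs.
have sw := preserves_swap mu.
have := preserves_comp (preserves_shear (- (s / (1 + c)))) (preserves_comp sw
  (preserves_comp (preserves_shear s) (preserves_comp sw (preserves_shear (- (s / (1 + c))))))).
congr preserves; apply/funext => -[a b] /=.
have c1 : 1 + c != 0 by rewrite gt_eqF// ltr_pwDl.
have es : s ^+ 2 = (1 - c) * (1 + c) by lra.
congr pair.
  transitivity (a * (1 - s ^+ 2 / (1 + c)) - s / (1 + c) * b * (2 - s ^+ 2 / (1 + c))).
    by field.
  by rewrite es mulfK//; field.
transitivity (s * a + b * (1 - s ^+ 2 / (1 + c))); first by field.
by rewrite es mulfK//; ring.
Qed.

End Rotation.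

(** * Rotations of four-dimensional space *)

Section Quaternion.
Context (R : realType).
Notation mu := (@lebesgue_measure R).
Notation mR := (measurableTypeR R).
Notation leb2 := (sigma_finite_prod mu mu).
Notation Q := ((mR * mR) * (mR * mR))%type.

Definition lebQ : {sigma_finite_measure set Q -> \bar R} := sigma_finite_prod leb2 leb2.

Lemma leb4E : @leb4 R = lebQ. Proof. by []. Qed.

Definition qdot (p q : quat R) : R :=
  p.1.1 * q.1.1 + p.1.2 * q.1.2 + p.2.1 * q.2.1 + p.2.2 * q.2.2.

Lemma qnormE (q : quat R) : qnorm q = Num.sqrt (qdot q q).
Proof. by rewrite /qnorm /qdot -!expr2. Qed.

(** The angle is the argument of the point [(p, q)]; [0 <= p] makes its cosine nonnegative, as the
    shear decomposition requires. At the origin the identity rotation serves. *)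
Lemma exists_rotation (p q : R) : 0 <= p -> exists c s : R,
  [/\ 0 <= c, c ^+ 2 + s ^+ 2 = 1, p * c + q * s = Num.sqrt (p ^+ 2 + q ^+ 2) &
      q * c = p * s].
Proof.
move=> p0; set r := Num.sqrt _.
have r2 : r ^+ 2 = p ^+ 2 + q ^+ 2 by rewrite sqr_sqrtr// addr_ge0// sqr_ge0.
have [r0|r0] := eqVneq r 0.
  move: r2; rewrite r0 expr0n/= => /esym/eqP.
  rewrite paddr_eq0 ?sqr_ge0// !sqrf_eq0 => /andP[/eqP-> /eqP->].
  by exists 1, 0; rewrite !mul0r addr0 expr1n expr0n/= addr0; split.
exists (p / r), (q / r); split.
- by rewrite divr_ge0// sqrtr_ge0.
- by rewrite !expr_div_n -mulrDl -r2 mulfV// expf_neq0.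
- by rewrite !mulrA -!expr2 -mulrDl -r2 expr2 mulfK.
- by ring.
Qed.

Lemma preserves_qrot (c s : R) : 0 <= c -> c ^+ 2 + s ^+ 2 = 1 ->
  [/\ preserves lebQ (fun u : Q => ((c * u.1.1 - s * u.1.2, s * u.1.1 + c * u.1.2), u.2)),
      preserves lebQ (fun u : Q => ((c * u.1.1 - s * u.2.1, u.1.2), (s * u.1.1 + c * u.2.1, u.2.2))) &
      preserves lebQ (fun u : Q => ((c * u.1.1 - s * u.2.2, u.1.2), (u.2.1, s * u.1.1 + c * u.2.2)))].
Proof.
move=> c0 cs.
have h1 := preserves_left leb2 (preserves_rotation c0 cs).
have hm := preserves_middle mu.
have hs := preserves_right leb2 (preserves_swap mu).
have h2 := preserves_comp hm (preserves_comp h1 hm).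
split; [exact: h1|exact: h2|exact: (preserves_comp hs (preserves_comp h2 hs))].
Qed.

(** Three plane rotations fold the coordinates of [a] into the first one at a time, so for nonzero
    [a] their composite sends the real unit to the direction of [a]. The sign of [a.1.1] serves the
    first rotation; the later radii are square roots, hence nonnegative. *)
Lemma quat_rotation (a : quat R) : 0 <= a.1.1 -> exists T : Q -> Q,
  [/\ preserves lebQ T, forall u, qdot (T u) (T u) = qdot u u &
      forall u, qdot a (T u) = qnorm a * u.1.1].
Proof.
move: a => [[a0 a1] [a2 a3]] /= a00.
have [c1 [s1 [c10 cs1 e1 f1]]] := exists_rotation a1 a00.
have [c2 [s2 [c20 cs2 e2 f2]]] := exists_rotation a2 (sqrtr_ge0 (a0 ^+ 2 + a1 ^+ 2)).
rewrite sqr_sqrtr ?addr_ge0 ?sqr_ge0// in e2.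
have [c3 [s3 [c30 cs3 e3 f3]]] :=
  exists_rotation a3 (sqrtr_ge0 (a0 ^+ 2 + a1 ^+ 2 + a2 ^+ 2)).
rewrite sqr_sqrtr ?addr_ge0 ?sqr_ge0// in e3.
have [T1 _ _] := preserves_qrot c10 cs1.
have [_ T2 _] := preserves_qrot c20 cs2.
have [_ _ T3] := preserves_qrot c30 cs3.
eexists; split; first exact: (preserves_comp T1 (preserves_comp T2 T3)).
- move=> [[u0 u1] [u2 u3]]; rewrite /qdot/=.
  have rot (c s x y : R) : c ^+ 2 + s ^+ 2 = 1 ->
    (c * x - s * y) * (c * x - s * y) + (s * x + c * y) * (s * x + c * y) =
    x * x + y * y.
    by move=> cs; rewrite -[RHS]mul1r -cs; ring.
  rewrite rot//.
  set x := c2 * _ - _; set y := s2 * _ + _.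
  have := rot c2 s2 (c3 * u0 - s3 * u3) u2 cs2; rewrite -/x -/y => h2.
  have h3 := rot c3 s3 u0 u3 cs3.
  lra.
- move=> [[u0 u1] [u2 u3]]; rewrite /qdot/= /qnorm/= -e3 -e2 -e1.
  set x := c3 * u0 - s3 * u3; set y := s3 * u0 + c3 * u3.
  (* For each rotation in turn, the relation [q * c = p * s] removes a cross term and the other
     relation merges two coordinates of [a] into their norm. *)
  transitivity ((a0 * c1 + a1 * s1) * (c2 * x - s2 * u2) +
     (a1 * c1 - a0 * s1) * u1 + a2 * (s2 * x + c2 * u2) + a3 * y); first by ring.
  rewrite f1 subrr mul0r addr0 e1.
  set r1 := Num.sqrt _ in e2 f2 *.
  transitivity ((r1 * c2 + a2 * s2) * x + (a2 * c2 - r1 * s2) * u2 + a3 * y); first by ring.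
  rewrite f2 subrr mul0r addr0 e2.
  set r2 := Num.sqrt _ in e3 f3 *.
  transitivity ((r2 * c3 + a3 * s3) * u0 + (a3 * c3 - r2 * s3) * u3).
    by rewrite /x /y; ring.
  by rewrite f3 subrr mul0r addr0.
Qed.

End Quaternion.

Section SigmaFinitePack.
Context d (T : measurableType d) (R : realType).
Variables (m : {measure set T -> \bar R}) (h : sigma_finite setT m).

(** Indexing the alias by the proof allows canonical structures to be attached to a measure whose
    sigma-finiteness is known only through [h]. *)
Definition sigma_finite_carrier (_ : sigma_finite setT m) : set T -> \bar R := m.
HB.instance Definition _ := Measure.on (sigma_finite_carrier h).
HB.instance Definition _ := Measure_isSigmaFinite.Build _ _ _ (sigma_finite_carrier h) h.
Definition sigma_finite_pack : {sigma_finite_measure set T -> \bar R} := sigma_finite_carrier h.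

End SigmaFinitePack.

(** * The normalized surface measure as a pushforward *)

Section SphereMeasure.
Context (R : realType).
Notation mu := (@lebesgue_measure R).
Notation mR := (measurableTypeR R).
Notation leb2 := (sigma_finite_prod mu mu).
Notation Q := ((mR * mR) * (mR * mR))%type.
Notation lebQ := (lebQ R).

Lemma ge0_integral_mrestr d (T : measurableType d) (m : {measure set T -> \bar R})
    (D : set T) (mD : measurable D) (f : T -> \bar R) :
  measurable_fun setT f -> (forall x, 0 <= f x)%E ->
  (\int[mrestr m mD]_x f x = \int[m]_(x in D) f x)%E.
Proof.
move=> mf f0; rewrite (@ge0_negligible_integral _ _ _ _ setT (~` D))//.
- rewrite setTD setCK; apply: eq_measure_integral => A mA AD.
  by rewrite /mrestr /=; congr (m _); apply/setIidPl.
- exact: measurableC.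
- by rewrite /= /mrestr setICl measure0.
Qed.

(** Inversion is continuous on the open complement of zero, and on the singleton at zero any
    function is measurable. *)
Lemma measurable_invr : measurable_fun setT (GRing.inv : mR -> mR).
Proof.
have m0 : measurable ([set 0] : set mR) by exact: measurable_set1.
rewrite -(setvU [set 0]); apply/measurable_funU => //; first exact: measurableC.
split; last exact: measurable_fun_set1.
apply: open_continuous_measurable_fun.
  by apply: closed_openC; exact: closed_eq.
by move=> x; rewrite inE/= => /eqP x0; exact: inv_continuous.
Qed.

Lemma measurable_qnorm : measurable_fun setT (@qnorm R : Q -> mR).
Proof.
have m11 : measurable_fun setT (fun u : Q => u.1.1) by exact: measurableT_comp.
have m12 : measurable_fun setT (fun u : Q => u.1.2) by exact: measurableT_comp.
have m21 : measurable_fun setT (fun u : Q => u.2.1) by exact: measurableT_comp.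
have m22 : measurable_fun setT (fun u : Q => u.2.2) by exact: measurableT_comp.
apply: measurableT_comp; first exact: (continuous_measurable_fun (@sqrt_continuous R)).
by repeat apply: measurable_funD; exact: measurable_funX.
Qed.

Definition qdir (u : Q) : Q := qscale (qnorm u)^-1 u.

Lemma measurable_qdir : measurable_fun setT qdir.
Proof.
have mi : measurable_fun setT (fun u : Q => (qnorm u)^-1 : mR).
  by apply: measurableT_comp; [exact: measurable_invr|exact: measurable_qnorm].
apply: measurable_fun_pair; apply: measurable_fun_pair;
  by apply: measurable_funM => //; exact: measurableT_comp.
Qed.

(** The origin has no direction, so the cone measure lives on the ball without it; the difference
    from [B4] is a null set. *)
Definition punctured_ball : set Q := [set u | 0 < qnorm u <= 1].

Lemma measurable_punctured_ball : measurable punctured_ball.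
Proof.
rewrite (_ : punctured_ball = @qnorm R @^-1` `]0, 1]%classic); last first.
  by apply/seteqP; split=> u; rewrite /punctured_ball /= in_itv/=.
by rewrite -[X in measurable X]setTI; exact: measurable_qnorm.
Qed.

Lemma qnormZ (t : R) (u : quat R) : 0 <= t -> qnorm (qscale t u) = t * qnorm u.
Proof.
move=> t0; rewrite /qnorm/= !exprMn -!mulrDr sqrtrM ?sqr_ge0//.
by rewrite sqrtr_sqr ger0_norm.
Qed.

Lemma qnorm_qdir (u : Q) : 0 < qnorm u -> qnorm (qdir u) = 1.
Proof. by move=> u0; rewrite /qdir qnormZ ?invr_ge0 ?ltW// mulVf// gt_eqF. Qed.

Lemma B4E : @B4 R = punctured_ball `|` [set u | qnorm u = 0].
Proof.
apply/seteqP; split=> u; rewrite /B4 /punctured_ball /=.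
  have := sqrtr_ge0 (u.1.1 ^+ 2 + u.1.2 ^+ 2 + u.2.1 ^+ 2 + u.2.2 ^+ 2).
  by rewrite -/(qnorm u) le_eqVlt => /orP[/eqP <-|->]; [right|left].
by case=> [/andP[]//|->].
Qed.

Lemma lebQ_setX (A B C D : set mR) : measurable A -> measurable B ->
    measurable C -> measurable D ->
  lebQ ((A `*` B) `*` (C `*` D)) = (mu A * mu B * (mu C * mu D))%E.
Proof.
move=> mA mB mC mD.
rewrite [LHS](@product_measure1E _ _ _ _ _ leb2 leb2) ; [|exact: measurableX..].
by congr (_ * _)%E; exact: product_measure1E.
Qed.

Lemma measurable_qnorm0 : measurable ([set u | qnorm u = 0] : set Q).
Proof.
rewrite (_ : [set u | _] = @qnorm R @^-1` [set 0])//.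
by rewrite -[X in measurable X]setTI; exact: measurable_qnorm.
Qed.

Lemma lebQ_qnorm0 : lebQ [set u | qnorm u = 0] = 0%E.
Proof.
have z1 : measurable ([set 0] : set mR) by exact: measurable_set1.
apply: (@subset_measure0 _ _ _ lebQ _
  ((([set 0] `*` [set 0]) `*` ([set 0] `*` [set 0])) : set Q)).
- exact: measurable_qnorm0.
- by apply: measurableX; apply: measurableX.
- move=> [[a b] [c d]] /= /eqP; rewrite /qnorm/= sqrtr_eq0 => h.
  have := sqr_ge0 a; have := sqr_ge0 b; have := sqr_ge0 c; have := sqr_ge0 d.
  move=> d0 c0 b0 a0.
  by split; split; apply/eqP; rewrite -sqrf_eq0; apply/eqP; lra.
- rewrite [LHS]lebQ_setX//.
  by rewrite lebesgue_measure_set1 !mul0e.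
Qed.

Lemma measurable_B4 : measurable (@B4 R : set Q).
Proof.
by rewrite B4E; apply: measurableU; [exact: measurable_punctured_ball|exact: measurable_qnorm0].
Qed.

Lemma lebQ_B4 : lebQ (@B4 R) = lebQ punctured_ball.
Proof.
by rewrite B4E measureU0//; [exact: measurable_punctured_ball|exact: measurable_qnorm0|exact: lebQ_qnorm0].
Qed.

(** Cubes of half-side [1 / 2] and [1] sandwich the ball. What is wanted is positivity and
    finiteness of the volume, so that [fine] in [sigma3] loses nothing and its inverse is
    genuine. *)
Lemma lebQ_B4_bounds : (1 <= lebQ (@B4 R) <= 16%:R%:E)%E.
Proof.
have mi (a b : R) : measurable (`[a, b] : set mR) by exact: measurable_itv.
have box (a : R) : measurable
    (((`[- a, a] `*` `[- a, a]) `*` (`[- a, a] `*` `[- a, a])) : set Q).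
  by apply: measurableX; apply: measurableX.
have vol (a : R) : 0 < a -> lebQ ((`[- a, a] `*` `[- a, a]) `*` (`[- a, a] `*` `[- a, a])) =
    ((2 * a) ^+ 4)%:E.
  move=> a0; rewrite [LHS]lebQ_setX// lebesgue_measure_itv/= lte_fin.
  rewrite ifT; last by lra.
  by rewrite -EFinD -!EFinM; congr EFin; ring.
apply/andP; split.
- rewrite [leLHS](_ : _ = lebQ ((`[- 2^-1, 2^-1] `*` `[- 2^-1, 2^-1]) `*`
      (`[- 2^-1, 2^-1] `*` `[- 2^-1, 2^-1]))); last first.
    by rewrite vol ?invr_gt0// divff// expr1n.
  apply: le_measure; rewrite ?inE; [exact: box|exact: measurable_B4|].
  move=> [[a b] [c d]] /= [[]]; rewrite !in_itv/= /B4/= => ha hb [hc hd].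
  have sq x : - 2^-1 <= x <= 2^-1 -> x ^+ 2 <= 4^-1 :> R by move=> ?; nra.
  have := sq _ ha; have := sq _ hb; have := sq _ hc; have := sq _ hd => *.
  rewrite -[leRHS]sqrtr1; apply: ler_wsqrtr => /=; lra.
- rewrite [leRHS](_ : _ = lebQ ((`[- 1, 1] `*` `[- 1, 1]) `*`
      (`[- 1, 1] `*` `[- 1, 1]))); last first.
    by rewrite vol// mulr1; congr EFin; ring.
  apply: le_measure; rewrite ?inE; [exact: measurable_B4|exact: box|].
  move=> [[a b] [c d]]; rewrite /B4/= /qnorm/= => h.
  have {}h : a ^+ 2 + b ^+ 2 + c ^+ 2 + d ^+ 2 <= 1.
    by rewrite -(@ler_sqrt _ _ 1)// sqrtr1.
  have := sqr_ge0 a; have := sqr_ge0 b; have := sqr_ge0 c; have := sqr_ge0 d.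
  move=> d0 c0 b0 a0; rewrite !in_itv/=.
  have sq (x : R) : x ^+ 2 <= 1 -> - 1 <= x <= 1.
    by move=> ?; rewrite -ler_norml -(@ler_pXn2r _ 2)// ?nnegrE// expr1n real_normK// num_real.
  by split; split; apply: sq; lra.
Qed.

Lemma cone_vol_ge0 : 0 <= (fine (leb4 (@B4 R)))^-1.
Proof. by rewrite invr_ge0 fine_ge0// leb4E measure_ge0. Qed.

(* [quat R] and [Q] carry the same sigma-algebra under different displays:
   [leb4] lives on [Q] and [muT2] on [QR * QR]. *)
Notation QR := ((R * R) * (R * R))%type.

Lemma measurable_qdirR : measurable_fun setT (qdir : Q -> QR).
Proof. exact: measurable_qdir. Qed.

Definition cone_measure : {measure set QR -> \bar R} :=
  mscale (NngNum cone_vol_ge0) (pushforward_measure (mrestr lebQ measurable_punctured_ball) measurable_qdirR).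

Lemma cone_measureE (A : set QR) : cone_measure A =
  ((fine (leb4 (@B4 R)))^-1%:E * lebQ (qdir @^-1` A `&` punctured_ball))%E.
Proof. reflexivity. Qed.

(** The condition on [S3] inside [cone] is automatic after normalization, so [sigma3] is a scaled
    pushforward of restricted Lebesgue measure. *)
Lemma sigma3E : @sigma3 R = cone_measure.
Proof.
apply/funext => A; rewrite cone_measureE /sigma3 leb4E; congr (_ * lebQ _)%E.
apply/seteqP; split=> u; rewrite /cone /punctured_ball /=.
  by case=> h [A1 _]; split.
case=> A1 h; split=> //; split=> //.
by rewrite /S3/=; apply: qnorm_qdir; case/andP: h.
Qed.

Lemma cone_measure_finite : fin_num_fun cone_measure.
Proof.
move=> A mA; have /andP[b1 b2] := lebQ_B4_bounds.
have mA' : measurable (qdir @^-1` A).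
  by rewrite -[X in measurable X]setTI; exact: measurable_qdirR.
rewrite cone_measureE fin_numM//.
have mAp : measurable (qdir @^-1` A `&` punctured_ball).
  by apply: measurableI; [exact: mA'|exact: measurable_punctured_ball].
have le16 : (lebQ (qdir @^-1` A `&` punctured_ball) <= 16%:R%:E)%E.
  apply: le_trans b2; rewrite lebQ_B4.
  by apply: le_measure; rewrite ?inE; [exact: mAp|exact: measurable_punctured_ball|exact: subIsetr].
rewrite ge0_fin_numE; first exact: le_lt_trans le16 (ltry _).
exact: measure_ge0.
Qed.

Lemma cone_measure_set0 : (cone_measure set0 < +oo)%E.
Proof. by rewrite measure0 ltry. Qed.

Definition sphere_measure : {sigma_finite_measure set QR -> \bar R} :=
  sigma_finite_pack (fin_num_fun_sigma_finite cone_measure_set0 cone_measure_finite).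

Lemma muT2E : @muT2 R = sigma_finite_prod sphere_measure sphere_measure.
Proof. by rewrite /muT2 sigma3E. Qed.

Lemma ge0_integral_sphere_measure (f : QR -> \bar R) :
  measurable_fun setT f -> (forall x, 0 <= f x)%E ->
  (\int[sphere_measure]_x f x =
   ((fine (leb4 (@B4 R)))^-1)%:E * \int[lebQ]_(u in punctured_ball) f (qdir u))%E.
Proof.
move=> mf f0; transitivity (\int[mscale (NngNum cone_vol_ge0)
  (pushforward_measure (mrestr lebQ measurable_punctured_ball) measurable_qdirR)]_x f x)%E; first by [].
rewrite ge0_integral_mscale//; congr (_ * _)%E.
rewrite (ge0_integral_pushforward measurable_qdirR _ measurableT mf); last first.
  by move=> x _; exact: f0.
rewrite preimage_setT.
have mfq : measurable_fun setT (f \o qdir).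
  exact: (measurableT_comp mf measurable_qdirR).
have fq0 u : (0 <= (f \o qdir) u)%E by exact: f0.
exact: (@ge0_integral_mrestr _ _ lebQ _ measurable_punctured_ball _ mfq fq0).
Qed.

End SphereMeasure.

(** * Slicing the ball along the real axis *)

Section Slicing.
Context (R : realType).
Notation mu := (@lebesgue_measure R).
Notation mR := (measurableTypeR R).
Notation leb2 := (sigma_finite_prod mu mu).
Notation Q := ((mR * mR) * (mR * mR))%type.
Notation lebQ := (lebQ R).
Local Open Scope ereal_scope.

Lemma lebQ_iter (h : Q -> \bar R) : measurable_fun setT h ->
  (forall z, 0 <= h z) ->
  \int[lebQ]_z h z = \int[leb2]_w \int[mu]_b \int[mu]_s h ((s, b), w).
Proof.
move=> mh h0; rewrite (tonelli2 h mh h0).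
apply: eq_integral => w _.
have mh1 : measurable_fun setT (fun p => h (p, w)) by exact: measurableT_comp.
by rewrite (tonelli2 _ mh1 (fun=> h0 _)).
Qed.

(** The secant of [atan v]: with [s = norm3 b w * v] the modulus of [((s, b), w)] is
    [norm3 b w * hypot1 v]. *)
Definition hypot1 (v : R) : R := Num.sqrt (1 + v ^+ 2).
Definition norm3 (b : R) (w : mR * mR) : R :=
  Num.sqrt (b ^+ 2 + w.1 ^+ 2 + w.2 ^+ 2).

Lemma hypot1_gt0 v : (0 < hypot1 v)%R.
Proof. by rewrite sqrtr_gt0 ltr_pwDl// sqr_ge0. Qed.

Lemma measurable_hypot1 : measurable_fun setT (hypot1 : mR -> mR).
Proof.
apply: measurableT_comp; first exact: (continuous_measurable_fun (@sqrt_continuous R)).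
by apply: measurable_funD => //; exact: measurable_funX.
Qed.

Lemma measurable_norm3 : measurable_fun setT (fun p : mR * (mR * mR) => norm3 p.1 p.2 : mR).
Proof.
apply: measurableT_comp; first exact: (continuous_measurable_fun (@sqrt_continuous R)).
by repeat apply: measurable_funD; apply: measurable_funX => //; exact: measurableT_comp.
Qed.

Lemma norm3_gt0 b w : b != 0%R -> (0 < norm3 b w)%R.
Proof.
move=> b0; rewrite sqrtr_gt0 -addrA ltr_pwDl ?addr_ge0 ?sqr_ge0//.
by rewrite lt_def sqrf_eq0 b0 sqr_ge0.
Qed.

Lemma norm3Z k b w : (0 <= k)%R ->
  norm3 (k * b) (k * w.1, k * w.2)%R = (k * norm3 b w)%R.
Proof.
move=> k0; rewrite /norm3/= !exprMn -!mulrDr sqrtrM ?sqr_ge0//.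
by rewrite sqrtr_sqr ger0_norm.
Qed.

Lemma qnorm_slice v b w :
  qnorm ((norm3 b w * v, b), w)%R = (norm3 b w * hypot1 v)%R.
Proof.
have e : (norm3 b w ^+ 2 = b ^+ 2 + w.1 ^+ 2 + w.2 ^+ 2)%R.
  by rewrite sqr_sqrtr ?addr_ge0 ?sqr_ge0.
have m0 : (0 <= norm3 b w)%R by exact: sqrtr_ge0.
rewrite /qnorm /hypot1 /= -[X in (_ = X * _)%R](ger0_norm m0) -sqrtr_sqr.
rewrite -sqrtrM ?sqr_ge0//; congr Num.sqrt.
by rewrite exprMn mulrDr mulr1 [X in (_ = X + _)%R]e; ring.
Qed.

(* Weight of the radius [m = |w|] in the slice of direction [v]; [k = hypot1 v]. *)
Definition radial_weight (k m : R) : \bar R := if (m * k <= 1)%R then m%:E else 0.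

Lemma radial_weight_ge0 k m : (0 <= m)%R -> 0 <= radial_weight k m.
Proof. by rewrite /radial_weight; case: ifP. Qed.

Lemma measurable_radial_weight d (T : measurableType d) (k m : T -> mR) :
  measurable_fun setT k -> measurable_fun setT m ->
  measurable_fun setT (fun x => radial_weight (k x) (m x)).
Proof.
move=> mk mm; apply: measurable_fun_ifT => //.
- apply: measurable_fun_ler => //; exact: measurable_funM.
- exact/measurable_EFinP.
Qed.

(** Its value stays undetermined; it cancels against the volume of the ball in
    [sphere_normalization]. *)
Definition radial_const : \bar R := \int[leb2]_w \int[mu]_b radial_weight 1 (norm3 b w).

Definition slice (G : R -> \bar R) : Q -> \bar R :=
  (fun u => G (u.1.1 / qnorm u)%R) \_ (@punctured_ball R).

Variables (G : R -> \bar R) (mG : measurable_fun setT (G : mR -> \bar R))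
  (G0 : forall x, 0 <= G x).

Lemma slice_ge0 u : 0 <= slice G u.
Proof. by rewrite /slice patchE; case: ifP. Qed.

Lemma measurable_slice : measurable_fun setT (slice G).
Proof.
have [+ _] := measurable_restrictT (fun u : Q => G (u.1.1 / qnorm u)%R) (@measurable_punctured_ball R).
apply; apply: measurable_funTS.
apply: (measurableT_comp mG); apply: measurable_funM.
  exact: measurableT_comp.
by apply: measurableT_comp; [exact: measurable_invr|exact: measurable_qnorm].
Qed.

(** The substitution [s = norm3 b w * v] makes the direction cosine a function of [v] alone. The
    Jacobian [norm3 b w] and the ball constraint combine into [radial_weight]; [b != 0] makes the
    scaling factor positive. *)
Lemma slice_scale w b : b != 0%R ->
  \int[mu]_s slice G ((s, b), w) =
  \int[mu]_v (radial_weight (hypot1 v) (norm3 b w) * G (v / hypot1 v)%R).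
Proof.
move=> b0; have m0 := norm3_gt0 w b0.
have ms : measurable_fun setT (fun s : mR => slice G ((s, b), w)).
  apply: (measurableT_comp measurable_slice).
  by apply: measurable_fun_pair => //; exact: measurable_fun_pair.
rewrite (ge0_integral_affine 0 m0 ms (fun=> slice_ge0 _)).
rewrite -ge0_integralZl_EFin//; last first.
- exact: ltW.
- by apply: (measurableT_comp ms); exact: measurable_affine.
- by move=> *; exact: slice_ge0.
apply: eq_integral => v _; rewrite addr0 /slice patchE /radial_weight.
have k0 := hypot1_gt0 v.
have -> : (((norm3 b w * v)%R, b, w) \in @punctured_ball R) = (norm3 b w * hypot1 v <= 1)%R.
  apply/idP/idP; rewrite inE /punctured_ball/= qnorm_slice; first by case/andP.
  by rewrite mulr_gt0.
case: ifPn => _; last by rewrite mule0 mul0e.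
rewrite qnorm_slice /=; congr (_ * G _).
by field; rewrite !gt_eqF.
Qed.

(** Homogeneity: scaling the three coordinates by [k^-1] contributes three factors [k^-1], and the
    weight itself a fourth. *)
Lemma radial_const_scale v :
  \int[leb2]_w \int[mu]_b radial_weight (hypot1 v) (norm3 b w) = ((hypot1 v ^+ 4)^-1)%:E * radial_const.
Proof.
have k0 := hypot1_gt0 v; set k := hypot1 v in k0 *.
have ki0 : (0 < k^-1)%R by rewrite invr_gt0.
pose h (p : mR * (mR * mR)) := radial_weight k (norm3 p.1 p.2).
have mh : measurable_fun setT h.
  by apply: measurable_radial_weight => //; exact: measurable_norm3.
have h0 p : 0 <= h p by exact/radial_weight_ge0/sqrtr_ge0.
pose h1 (p : mR * (mR * mR)) := radial_weight 1 (norm3 p.1 p.2).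
have mh1 : measurable_fun setT h1.
  by apply: measurable_radial_weight => //; exact: measurable_norm3.
have h10 p : 0 <= h1 p by exact/radial_weight_ge0/sqrtr_ge0.
have hE b c d : h ((k^-1 * b)%R, ((k^-1 * c)%R, (k^-1 * d)%R)) =
    (k^-1)%:E * h1 (b, (c, d)).
  rewrite /h /h1 (norm3Z _ (c, d) (ltW ki0)) /radial_weight /= mulrAC mulVf ?gt_eqF// mul1r mulr1.
  by case: ifPn => _; rewrite ?mule0// -EFinM.
have m3 (f : mR * (mR * mR) -> \bar R) : measurable_fun setT f ->
    (forall p, 0 <= f p) ->
    \int[leb2]_w \int[mu]_b f (b, w) =
    \int[mu]_d \int[mu]_c \int[mu]_b f (b, (c, d)).
  move=> mf f0; have mF := measurable_fun_fubini_tonelli_G (m1 := mu) f mf f0.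
  have F0 w : 0 <= \int[mu]_b f (b, w) by exact: integral_ge0.
  exact: (tonelli2 (fun w => \int[mu]_b f (b, w)) mF F0).
rewrite /radial_const (m3 h mh h0) (m3 h1 mh1 h10).
pose I1 cd := \int[mu]_b h (b, cd).
have mI1 : measurable_fun setT I1 := measurable_fun_fubini_tonelli_G (m1 := mu) h mh h0.
have I10 cd : 0 <= I1 cd by exact: integral_ge0.
pose J1 cd := \int[mu]_b h1 (b, cd).
have mJ1 : measurable_fun setT J1 := measurable_fun_fubini_tonelli_G (m1 := mu) h1 mh1 h10.
have J10 cd : 0 <= J1 cd by exact: integral_ge0.
have e1 c d : I1 ((k^-1 * c)%R, (k^-1 * d)%R) = (k^-1 * k^-1)%:E * J1 (c, d).
  have mhb w : measurable_fun setT (fun b => h (b, w)) by exact: measurableT_comp.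
  have mh1b w : measurable_fun setT (fun b => h1 (b, w)) by exact: measurableT_comp.
  rewrite /I1 (ge0_integral_affine 0 ki0 (mhb _) (fun=> h0 _)).
  under eq_integral do rewrite addr0 hE.
  rewrite (ge0_integralZl_EFin _ measurableT (fun b _ => h10 _) (mh1b _)); last exact: ltW.
  by rewrite muleA -EFinM.
pose I2 d := \int[mu]_c I1 (c, d).
have mI2 : measurable_fun setT I2 := measurable_fun_fubini_tonelli_G (m1 := mu) I1 mI1 I10.
have I20 d : 0 <= I2 d by exact: integral_ge0.
pose J2 d := \int[mu]_c J1 (c, d).
have mJ2 : measurable_fun setT J2 := measurable_fun_fubini_tonelli_G (m1 := mu) J1 mJ1 J10.
have J20 d : 0 <= J2 d by exact: integral_ge0.
have e2 d : I2 (k^-1 * d)%R = (k^-1 * k^-1 * k^-1)%:E * J2 d.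
  have mIb w : measurable_fun setT (fun b => I1 (b, w)) by exact: measurableT_comp.
  have mJb w : measurable_fun setT (fun b => J1 (b, w)) by exact: measurableT_comp.
  rewrite /I2 (ge0_integral_affine 0 ki0 (mIb _) (fun=> I10 _)).
  under eq_integral do rewrite addr0 e1.
  rewrite (ge0_integralZl_EFin _ measurableT (fun b _ => J10 _) (mJb _)).
    by rewrite muleA -EFinM mulrA.
  by rewrite mulr_ge0// ltW.
change (\int[mu]_d I2 d = ((k ^+ 4)^-1)%:E * \int[mu]_d J2 d).
clearbody I2 J2.
rewrite (ge0_integral_affine 0 ki0 mI2 I20).
have -> : \int[mu]_d I2 (k^-1 * d + 0)%R =
    \int[mu]_d ((k^-1 * k^-1 * k^-1)%:E * J2 d).
  by apply: eq_integral => d _; rewrite addr0; exact: e2.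
rewrite (ge0_integralZl_EFin _ measurableT (fun b _ => J20 _) mJ2).
  by rewrite muleA -EFinM; congr (_%:E * _); field; rewrite gt_eqF.
by rewrite !mulr_ge0// ltW.
Qed.

(* Scaling [s = |w| v] at fixed [w] turns the direction cosine of [(s, w)] into
   [v / sqrt (1 + v ^ 2)], so that the radial integral factors out. *)
Lemma integral_slice :
  \int[lebQ]_u slice G u =
  radial_const * \int[mu]_v (((hypot1 v ^+ 4)^-1)%:E * G (v / hypot1 v)%R).
Proof.
have mGv : measurable_fun setT (fun v : mR => G (v / hypot1 v)%R).
  apply: (measurableT_comp mG); apply: measurable_funM => //.
  by apply: measurableT_comp; [exact: measurable_invr|exact: measurable_hypot1].
pose F (p : (mR * (mR * mR)) * mR) :=
  radial_weight (hypot1 p.2) (norm3 p.1.1 p.1.2) * G (p.2 / hypot1 p.2)%R.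
have mF : measurable_fun setT F.
  apply: emeasurable_funM.
    apply: measurable_radial_weight.
      by apply: (measurableT_comp measurable_hypot1).
    by apply: (measurableT_comp measurable_norm3).
  by apply: (measurableT_comp mGv).
have F0 p : 0 <= F p by apply: mule_ge0 => //; exact/radial_weight_ge0/sqrtr_ge0.
rewrite (lebQ_iter measurable_slice slice_ge0).
pose F1 bw := \int[mu]_v F (bw, v).
have mF1 : measurable_fun setT F1 := measurable_fun_fubini_tonelli_F (m2 := mu) F mF F0.
have F10 bw : 0 <= F1 bw by exact: integral_ge0.
transitivity (\int[leb2]_w \int[mu]_b F1 (b, w)).
  apply: eq_integral => w _.
  pose Sl (p : (mR * (mR * mR)) * mR) := slice G ((p.2, p.1.1), p.1.2).
  have mSl : measurable_fun setT Sl.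
    apply: (measurableT_comp measurable_slice).
    apply: measurable_fun_pair; last exact: measurableT_comp.
    by apply: measurable_fun_pair => //; exact: measurableT_comp.
  have mS1 := measurable_fun_fubini_tonelli_F (m2 := mu) Sl mSl (fun=> slice_ge0 _).
  have mp : measurable_fun setT (fun b : mR => (b, w)) by exact: measurable_fun_pair.
  apply: ge0_ae_eq_integral => //.
  - exact: (measurableT_comp mS1 mp).
  - exact: (measurableT_comp mF1 mp).
  - by move=> b _; apply: integral_ge0 => *; exact: slice_ge0.
  (* The scaling needs a positive [norm3 b w], which can fail at [b = 0]; that value is discarded as
     a null set. *)
  - exists [set 0%R]; split; [exact: measurable_set1|exact: lebesgue_measure_set1|].
    move=> b /=; apply: contra_notP => /eqP b0 _.
    exact: slice_scale.
(* Tonelli brings [v] outermost, so that the weight can be integrated out for each [v]. *)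
have -> : \int[leb2]_w \int[mu]_b F1 (b, w) =
    \int[mu]_v \int[leb2]_w \int[mu]_b F ((b, w), v).
  transitivity (\int[sigma_finite_prod mu leb2]_bw F1 bw); first by rewrite (tonelli2 _ mF1 F10).
  rewrite -(tonelli1 F mF F0) (tonelli2 F mF F0).
  apply: eq_integral => v _.
  have mFv : measurable_fun setT (fun bw => F (bw, v)) by exact: measurableT_comp.
  by rewrite (tonelli2 _ mFv (fun=> F0 _)).
have mW v : measurable_fun setT (fun bw : mR * (mR * mR) => radial_weight (hypot1 v) (norm3 bw.1 bw.2)).
  by apply: measurable_radial_weight => //; exact: measurable_norm3.
have W0 v (bw : mR * (mR * mR)) : 0 <= radial_weight (hypot1 v) (norm3 bw.1 bw.2).
  exact/radial_weight_ge0/sqrtr_ge0.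
transitivity (\int[mu]_v (((hypot1 v ^+ 4)^-1)%:E * G (v / hypot1 v)%R * radial_const)).
  apply: eq_integral => v _.
  have mWw w : measurable_fun setT (fun b : mR => radial_weight (hypot1 v) (norm3 b w)).
    have mp : measurable_fun setT (fun b : mR => (b, w)) by exact: measurable_fun_pair.
    exact: (measurableT_comp (mW v) mp).
  transitivity (\int[leb2]_w ((\int[mu]_b radial_weight (hypot1 v) (norm3 b w)) * G (v / hypot1 v)%R)).
    apply: eq_integral => w _.
    rewrite /F/= ge0_integralZr//.
    by move=> b _; exact: (W0 v (b, w)).
  rewrite ge0_integralZr//.
  - by rewrite radial_const_scale muleAC.
  - exact: (measurable_fun_fubini_tonelli_G (m1 := mu) _ (mW v) (W0 v)).
  - by move=> w _; apply: integral_ge0 => b _; exact: (W0 v (b, w)).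
have K0 : 0 <= radial_const.
  by apply: integral_ge0 => w _; apply: integral_ge0 => b _; exact/radial_weight_ge0/sqrtr_ge0.
rewrite ge0_integralZr// 1?muleC//.
- apply: emeasurable_funM => //; apply/measurable_EFinP.
  apply: measurableT_comp; first exact: measurable_invr.
  by apply: measurable_funX; exact: measurable_hypot1.
- by move=> v _; apply: mule_ge0 => //; rewrite lee_fin invr_ge0 exprn_ge0// ltW// hypot1_gt0.
Qed.

End Slicing.

(** * Antiderivatives and the substitution by the arctangent *)

Section AtanSubstitution.
Context (R : realType).
Notation mu := (@lebesgue_measure R).

(** The bound [c] is chosen beyond the segment of interest, so that two-sided derivatives exist at
    its endpoints too: [3] serves for [pi / 2], and [4] for [pi]. *)
Lemma exists_antiderivative (g : R -> R) (c : R) : continuous g ->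
  exists P : R -> R, forall x : R, `|x| < c -> is_derive x (1 : R) P (g x).
Proof.
move=> cg; pose P x := \int[mu]_(t in `[- c, x]) g t; exists P => x.
rewrite ltr_norml => /andP[x1 x2].
have ig : mu.-integrable `[- c, c] (EFin \o g).
  apply: continuous_compact_integrable; first exact: segment_compact.
  exact: continuous_subspaceT.
have : derivable P x 1 /\ derive1 P x = g x := continuous_FTC1_closed x2 ig x1 (cg x).
move: (P) => {}P [d e]; have {}e : 'D_1 P x = g x by rewrite -derive1E.
exact: DeriveDef.
Qed.

Lemma is_derive_continuous (P : R -> R) (x l : R) :
  is_derive x (1 : R) P l -> {for x, continuous P}.
Proof.
move=> dx; apply: differentiable_continuous; apply/derivable1_diffP.
exact: ex_derive.
Qed.

Lemma FTC2_is_derive (g P : R -> R) (a b : R) : a < b -> continuous g ->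
  (forall x : R, a <= x <= b -> is_derive x (1 : R) P (g x)) ->
  (\int[mu]_(x in `[a, b]) (g x)%:E = (P b - P a)%:E)%E.
Proof.
move=> ab cg dP; rewrite (@continuous_FTC2 _ g P)//.
- exact: continuous_subspaceT.
- have cP x : a <= x <= b -> {for x, continuous P}.
    by move=> /dP dx; exact: is_derive_continuous dx.
  split.
  + by move=> x; rewrite in_itv/= => /andP[ax xb]; apply: (@ex_derive _ _ _ _ _ _ _ (dP x _)); rewrite !ltW.
  + by apply: cvg_at_right_filter; apply: cP; rewrite lexx ltW.
  + by apply: cvg_at_left_filter; apply: cP; rewrite lexx ltW.
- move=> x; rewrite in_itv/= => /andP[ax xb]; rewrite derive1E.
  by have := dP x; rewrite !ltW// => /(_ isT) dx; exact: derive_val.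
Qed.

(** Both sides are increments of one antiderivative: [P \o atan] is an antiderivative on the half
    line, with limit [P (pi / 2)] at infinity. *)
Lemma integral_atan0y (g : R -> R) : continuous g -> (forall x, 0 <= g x) ->
  (\int[mu]_(v in `[0%R, +oo[) (g (atan v) / (1 + v ^+ 2))%:E =
   \int[mu]_(x in `[0%R, (pi / 2)%R]) (g x)%:E)%E.
Proof.
move=> cg g0; have [P dP] := exists_antiderivative 3 cg.
have /andP[pi0 pi2] : 0 < (pi : R) / 2 < 2.
  by have h1 := pihalf_ge1 R; have h2 := pihalf_lt2 R; apply/andP; split; lra.
have dP' (x : R) : - (pi / 2) <= x <= pi / 2 -> is_derive x 1 P (g x).
  by move=> /andP[x1 x2]; apply: dP; rewrite ltr_norml; apply/andP; split; lra.
have dP0 (x : R) : 0 <= x <= pi / 2 -> is_derive x (1 : R) P (g x).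
  by move=> /andP[x0 x1]; apply: dP'; apply/andP; split; lra.
rewrite (FTC2_is_derive pi0 cg dP0).
have at_ (v : R) : - (pi / 2) < atan v < pi / 2 by rewrite atan_gtNpi2 atan_ltpi2.
have dF (v : R) : is_derive v 1 (P \o atan) (g (atan v) / (1 + v ^+ 2)).
  have da : is_derive v 1 (@atan R) (1 + v ^+ 2)^-1.
    by apply: DeriveDef; [exact: derivable_atan|rewrite -derive1E derive1_atan].
  have dPa : is_derive (atan v) 1 P (g (atan v)).
    by have /andP[] := at_ v => ? ?; apply: dP'; rewrite !ltW.
  by apply: is_derive_eq; rewrite /GRing.scale/= mulrC.
have ca : continuous (fun v : R => g (atan v) / (1 + v ^+ 2)).
  move=> v; apply: cvgM.
    by apply: continuous_comp; [exact: continuous_atan|exact: cg].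
  exact: continuous_oneDsqrV.
rewrite (@ge0_continuous_FTC2y _ _ (P \o atan) 0 (P (pi / 2))).
- by rewrite /= atan0.
- by move=> v _; rewrite divr_ge0// addr_ge0// sqr_ge0.
- exact: continuous_subspaceT.
- apply: (cvg_comp _ _ (@cvgy_atan R)).
  apply: (is_derive_continuous (dP' (pi / 2) _)).
  by apply/andP; split; lra.
- by move=> v _; exact: (@ex_derive _ _ _ _ _ _ _ (dF v)).
- by apply: cvg_at_right_filter; exact: (is_derive_continuous (dF 0)).
- by move=> v _; rewrite derive1E; exact: derive_val.
Qed.

(** The negative half line is reflected onto the positive one, and the two halves of the segment are
    glued by antiderivatives. *)
Lemma integral_atan (g : R -> R) : continuous g -> (forall x, 0 <= g x) ->
  (\int[mu]_v (g (atan v) / (1 + v ^+ 2))%:E =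
   \int[mu]_(x in `[(- (pi / 2))%R, (pi / 2)%R]) (g x)%:E)%E.
Proof.
move=> cg g0.
have /andP[pi0 pi2] : 0 < (pi : R) / 2 < 2.
  by have h1 := pihalf_ge1 R; have h2 := pihalf_lt2 R; apply/andP; split; lra.
have cgN : continuous (fun x => g (- x)).
  by move=> x; apply: continuous_comp; [exact: continuousN|exact: cg].
have ca (h : R -> R) : continuous h -> continuous (fun v : R => h (atan v) / (1 + v ^+ 2)).
  move=> ch v; apply: cvgM.
    by apply: continuous_comp; [exact: continuous_atan|exact: ch].
  exact: continuous_oneDsqrV.
have mf : measurable_fun setT (fun v : R => (g (atan v) / (1 + v ^+ 2))%:E).
  by apply/measurable_EFinP; apply: continuous_measurable_fun; exact: ca.
have f0 (v : R) : (0 <= (g (atan v) / (1 + v ^+ 2))%:E)%E.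
  by rewrite lee_fin divr_ge0// addr_ge0// sqr_ge0.
rewrite -(itv_setU_setT false (0 : R)) ge0_integral_setU//=; last 2 first.
- by rewrite itv_setU_setT.
- by apply/disj_setPS => x [] /=; rewrite !in_itv/= andbT => x0 x1; lra.
have -> : (\int[mu]_(v in `]-oo, 0%R]) (g (atan v) / (1 + v ^+ 2))%:E =
    \int[mu]_(x in `[0%R, (pi / 2)%R]) (g (- x))%:E)%E.
  rewrite -(integral_atan0y cgN)// ge0_integration_by_substitution0//.
  - by apply: eq_integral => v _; rewrite atanN opprK sqrrN.
  - by apply/measurable_EFinP; apply: continuous_measurable_fun; exact: (ca (fun x => g (- x))).
  - by move=> v; rewrite lee_fin divr_ge0// addr_ge0// sqr_ge0.
rewrite integral_itv_obnd_cbnd; last exact: measurable_funTS.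
rewrite integral_atan0y//.
have [P dP] := exists_antiderivative 3 cg.
have dP' (x : R) : - (pi / 2) <= x <= pi / 2 -> is_derive x 1 P (g x).
  by move=> /andP[x1 x2]; apply: dP; rewrite ltr_norml; apply/andP; split; lra.
have dP0 (x : R) : 0 <= x <= pi / 2 -> is_derive x (1 : R) P (g x).
  by move=> /andP[x0 x1]; apply: dP'; apply/andP; split; lra.
have piN : - (pi / 2) < pi / 2 :> R by lra.
have dPN (x : R) : 0 <= x <= pi / 2 ->
    is_derive x (1 : R) (fun x => - P (- x)) (g (- x)).
  move=> /andP[x0 x1].
  have dx : is_derive (- x) (1 : R) P (g (- x)).
    by apply: dP'; apply/andP; split; lra.
  have dn : is_derive x (1 : R) (fun x : R => - x) (- 1) by exact: is_derive_eq.
  have := is_deriveN (is_derive1_comp dx dn).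
  by move=> h; apply: is_derive_eq; rewrite /GRing.scale/= mulrN1 opprK.
rewrite (FTC2_is_derive pi0 cg dP0) (FTC2_is_derive pi0 cgN dPN).
rewrite (FTC2_is_derive piN cg dP').
rewrite -EFinD; congr EFin; rewrite oppr0; ring.
Qed.

End AtanSubstitution.

(** * The law of a coordinate on the sphere *)

Section SphereLaw.
Context (R : realType).
Notation mu := (@lebesgue_measure R).
Notation mR := (measurableTypeR R).
Notation Q := ((mR * mR) * (mR * mR))%type.
Notation QR := ((R * R) * (R * R))%type.
Notation lebQ := (lebQ R).
Notation sphere_measure := (sphere_measure R).

(** With [v = tan x] one has [dx = dv / (1 + v ^+ 2)], so the slicing density in [v] becomes
    [cos x ^+ 2] in the latitude [x], and the direction cosine becomes [sin x]. *)
Lemma cos2_atan (v : R) : cos (atan v) ^+ 2 / (1 + v ^+ 2) = (hypot1 v ^+ 4)^-1.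
Proof.
have k2 : hypot1 v ^+ 2 = 1 + v ^+ 2 by rewrite sqr_sqrtr// addr_ge0// sqr_ge0.
rewrite cos_atan -/(hypot1 v) -k2; field.
by rewrite gt_eqF// hypot1_gt0.
Qed.

Lemma sin_atan (v : R) : sin (atan v) = v / hypot1 v.
Proof.
have c0 : cos (atan v) != 0.
  by rewrite gt_eqF// cos_gt0_pihalf// atan_gtNpi2 atan_ltpi2.
rewrite -[X in X / _]atanK /hypot1 -cos_atan /tan mulfVK//.
Qed.

Lemma continuous_cosX2 : continuous (fun x : R => cos x ^+ 2).
Proof. by move=> x; apply: (@continuous_comp _ _ _ (@cos R) (fun y => y ^+ 2));
  [exact: continuous_cos|exact: exprn_continuous]. Qed.

Lemma integral_hypot1_pow4 : (\int[mu]_v ((hypot1 v ^+ 4)^-1)%:E = (pi / 2)%:E)%E.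
Proof.
under eq_integral do rewrite -cos2_atan.
rewrite (@integral_atan _ (fun x => cos x ^+ 2))//; last 2 first.
- exact: continuous_cosX2.
- by move=> x; exact: sqr_ge0.
have piN : - (pi / 2) < pi / 2 :> R by rewrite gtrN// divr_gt0// pi_gt0.
have dP (x : R) : - (pi / 2) <= x <= pi / 2 ->
    is_derive x (1 : R) (fun x => (x + sin x * cos x) / 2) (cos x ^+ 2).
  move=> _; apply: is_derive_eq; rewrite /GRing.scale/=.
  by have := cos2Dsin2 x => e; lra.
rewrite (FTC2_is_derive piN continuous_cosX2 dP).
by rewrite cosN sinN cos_pihalf; congr EFin; field.
Qed.

Lemma lebQ_punctured_ball : (lebQ (@punctured_ball R) = radial_const R * (pi / 2)%:E)%E.
Proof.
have m1 : measurable_fun setT (cst 1%E : mR -> \bar R) by exact: measurable_cst.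
have := integral_slice m1 (fun=> lee01).
under [X in (_ = _ * X)%E]eq_integral do rewrite mule1.
rewrite integral_hypot1_pow4 => <-.
rewrite /slice -integral_mkcond integral_cst ?mul1e//.
exact: measurable_punctured_ball.
Qed.

(** Slicing the constant [1] gives the volume of the ball as [radial_const R * (pi / 2)], so the
    ratio is [2 / pi] whatever [radial_const R] is; the volume bounds permit the division. *)
Lemma sphere_normalization (X : \bar R) :
  ((fine (leb4 (@B4 R)))^-1%:E * (radial_const R * X) = (2 / pi)%:E * X)%E.
Proof.
have pi0 := pi_gt0 R; have /andP[] := lebQ_B4_bounds R.
rewrite leb4E lebQ_B4 lebQ_punctured_ball.
set K := radial_const R; set V := (K * _)%E => V1 V16.
have Vf : V \is a fin_num.
  by rewrite ge0_fin_numE; [exact: le_lt_trans V16 (ltry _)|exact: le_trans V1].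
have -> : K = (V * (2 / pi)%:E)%E.
  rewrite /V -muleA -EFinM (_ : (pi : R) / 2 * (2 / pi) = 1) ?mule1//.
  by rewrite mulrA divfK ?pnatr_eq0// mulfV// gt_eqF.
have V0 : 0 < fine V.
  by rewrite -lte_fin fineK//; apply: lt_le_trans V1; exact: lte01.
rewrite -[in X in (_ * X)%E](fineK Vf) -EFinM muleA -EFinM mulrA mulVf ?mul1r//.
by rewrite gt_eqF.
Qed.

Lemma measurable_qdot (a : quat R) : measurable_fun setT (qdot a : QR -> R).
Proof.
by repeat apply: measurable_funD; apply: measurable_funM => //; exact: measurableT_comp.
Qed.

Lemma qdotZ (a u : quat R) t : qdot a (qscale t u) = t * qdot a u.
Proof. by rewrite /qdot/=; ring. Qed.

(** A rotation of the ball turns [qdot a] into [qnorm a] times the real coordinate, after which the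
    slicing formula applies. *)
Lemma integral_sphere_v (a : quat R) (G : R -> \bar R) : 0 <= a.1.1 ->
  measurable_fun setT G -> (forall x, 0 <= G x)%E ->
  (\int[sphere_measure]_y G (qdot a y) =
   (2 / pi)%:E * \int[mu]_v (((hypot1 v ^+ 4)^-1)%:E * G (qnorm a * (v / hypot1 v))%R))%E.
Proof.
move=> a0 mG G0.
have mGq : measurable_fun setT (G \o qdot a : QR -> _).
  by apply: measurableT_comp => //; exact: measurable_qdot.
rewrite (ge0_integral_sphere_measure mGq (fun=> G0 _)) -[RHS]sphere_normalization.
congr (_ * _)%E.
have mGa : measurable_fun setT ((fun t => G (qnorm a * t)) : mR -> \bar R).
  by apply: measurableT_comp => //; exact: measurable_funM.
rewrite -(integral_slice mGa (fun=> G0 _)) integral_mkcond.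
have [T [[mT hT] nT dT]] := quat_rotation a0.
set f := (X in (\int[_]_x X x)%E = _).
have mf : measurable_fun setT (f : Q -> \bar R).
  have [+ _] := measurable_restrictT (G \o qdot a \o @qdir R : Q -> _) (@measurable_punctured_ball R).
  apply; apply: measurable_funTS.
  by apply: (measurableT_comp mGq); exact: measurable_qdirR.
have f0 u : (0 <= f u)%E.
  by rewrite /f patchE; case: ifP => _; [exact: G0|exact: lexx].
rewrite -(hT f mf f0); apply: eq_integral => u _.
have nTu : qnorm (T u) = qnorm u by rewrite !qnormE nT.
rewrite /f /slice !patchE.
have -> : (T u \in @punctured_ball R) = (u \in @punctured_ball R).
  by apply/idP/idP; rewrite !inE /punctured_ball/= nTu.
case: ifP => // _; rewrite /= /qdir qdotZ dT nTu.
by congr (G _); ring.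
Qed.

(* The exceptional latitude [t0] accommodates integrands known only almost
   everywhere. *)
Lemma integral_sphere (a : quat R) (G : R -> \bar R) (h : R -> R) (t0 : R) :
  0 <= a.1.1 -> measurable_fun setT G -> (forall x, 0 <= G x)%E ->
  continuous h -> (forall x, 0 <= h x) ->
  (forall x, - (pi / 2) < x < pi / 2 -> x != t0 ->
    G (qnorm a * sin x) = (h x)%:E) ->
  (\int[sphere_measure]_y G (qdot a y) =
   (2 / pi)%:E * \int[mu]_(x in `[(- (pi / 2))%R, (pi / 2)%R]) (h x * cos x ^+ 2)%:E)%E.
Proof.
move=> a0 mG G0 ch h0 hG; rewrite integral_sphere_v//; congr (_ * _)%E.
have cg : continuous (fun x => h x * cos x ^+ 2).
  by move=> x; apply: cvgM; [exact: ch|exact: continuous_cosX2].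
have g0 x : 0 <= h x * cos x ^+ 2 by rewrite mulr_ge0// sqr_ge0.
rewrite -(integral_atan cg g0).
have mk : measurable_fun setT (fun v : mR => (hypot1 v)^-1).
  by apply: measurableT_comp; [exact: measurable_invr|exact: measurable_hypot1].
apply: ge0_ae_eq_integral => //.
- apply: emeasurable_funM.
    apply/measurable_EFinP; apply: measurableT_comp; first exact: measurable_invr.
    by apply: measurable_funX; exact: measurable_hypot1.
  apply: measurableT_comp => //; apply: measurable_funM => //.
  exact: measurable_funM.
- apply/measurable_EFinP; apply: continuous_measurable_fun => v; apply: cvgM.
    apply: (@continuous_comp _ _ _ (@atan R) (fun x => h x * cos x ^+ 2)).
      exact: continuous_atan.
    exact: cg.
  exact: continuous_oneDsqrV.
- by move=> v _; rewrite mule_ge0// lee_fin invr_ge0 exprn_ge0// ltW// hypot1_gt0.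
- by move=> v _; rewrite lee_fin divr_ge0// addr_ge0// sqr_ge0.
- exists [set tan t0]; split; [exact: measurable_set1|exact: lebesgue_measure_set1|].
  move=> v /=; apply: contra_notP => vt _.
  rewrite -sin_atan hG; last 2 first.
  + by rewrite atan_gtNpi2 atan_ltpi2.
  + by apply/eqP => e; apply: vt; rewrite -e atanK.
  by rewrite -EFinM -cos2_atan; congr EFin; ring.
Qed.

End SphereLaw.

(** * Cosine series of the logarithm with explicit remainder *)

Section Fourier.
Context (R : realType).
Implicit Types (r s t c x : R).

(** Both [g - f] and [g + f] are nondecreasing on the segment. This takes the place of integrating a
    pointwise bound. *)
Lemma derive_comparison (f g f1 g1 : R -> R) (a b : R) : a <= b ->
  (forall x, a <= x <= b -> is_derive x (1 : R) f (f1 x)) ->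
  (forall x, a <= x <= b -> is_derive x (1 : R) g (g1 x)) ->
  (forall x, a <= x <= b -> `|f1 x| <= g1 x) ->
  `|f b - f a| <= g b - g a.
Proof.
move=> ab df dg fg.
have mono (h h1 : R -> R) :
    (forall x, a <= x <= b -> is_derive x (1 : R) h (h1 x)) ->
    (forall x, a <= x <= b -> 0 <= h1 x) -> h a <= h b.
  move=> dh h0.
  have ch : {within `[a, b], continuous h}.
    apply: derivable_within_continuous => x; rewrite in_itv/= => xab.
    by have dx := dh x xab; exact: ex_derive.
  have dh' x : x \in `]a, b[ -> is_derive x (1 : R) h (h1 x).
    by rewrite in_itv/= => /andP[ax xb]; apply: dh; rewrite !ltW.
  have [x xab e] := MVT_segment ab dh' ch.
  rewrite -subr_ge0 e mulr_ge0 ?subr_ge0//; apply: h0.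
  by rewrite in_itv/= in xab.
have m1 : g a - f a <= g b - f b.
  apply: (mono (g - f) (fun x => g1 x - f1 x)) => x xab.
    by have d1 := df x xab; have d2 := dg x xab; exact: is_deriveB.
  by have := fg x xab; rewrite ler_norml subr_ge0 => /andP[].
have m2 : g a + f a <= g b + f b.
  apply: (mono (g + f) (fun x => g1 x + f1 x)) => x xab.
    by have d1 := df x xab; have d2 := dg x xab; exact: is_deriveD.
  by have := fg x xab; rewrite ler_norml => /andP[h _]; lra.
by rewrite ler_norml; apply/andP; split; lra.
Qed.

Lemma is_derive_monomial (k : R) (n : nat) (s : R) :
  is_derive s (1 : R) (fun s => k * s ^+ n.+1) (k * (n.+1%:R * s ^+ n)).
Proof.
have := is_deriveZ k (is_deriveX n.+1 (is_derive_id s (1 : R))).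
congr is_derive; last by rewrite /GRing.scale/= mulr1.
by apply/funext => x; rewrite exprfctE.
Qed.

(** Partial sums for [log |1 + r * exp (i t)|]; index [n] carries frequency [n + 1]. *)
Definition fourier_sum (N : nat) r t : R :=
  \sum_(n < N) (-1) ^+ n * r ^+ n.+1 / n.+1%:R * cos (n.+1%:R * t).

Lemma cos_rec (n : nat) t :
  cos (n.+2%:R * t) = 2 * cos t * cos (n.+1%:R * t) - cos (n%:R * t).
Proof.
have -> : n.+2%:R * t = n.+1%:R * t + t by rewrite -[n.+2%:R]natr1; ring.
have -> : n%:R * t = n.+1%:R * t - t by rewrite -natr1; ring.
by rewrite cosD cosB; ring.
Qed.

Lemma is_derive_fourier_sum (N : nat) s t :
  is_derive s (1 : R) (fun s => fourier_sum N s t)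
    (\sum_(n < N) (-1) ^+ n * s ^+ n * cos (n.+1%:R * t)).
Proof.
elim: N => [|N IH].
  rewrite big_ord0 (_ : (fun s => _) = cst 0); first exact: is_derive_cst.
  by apply/funext => x; rewrite /fourier_sum big_ord0.
rewrite big_ord_recr/=.
have dt : is_derive s (1 : R)
    (fun s => ((-1) ^+ N / N.+1%:R * cos (N.+1%:R * t)) * s ^+ N.+1)
    ((-1) ^+ N * s ^+ N * cos (N.+1%:R * t)).
  have := is_derive_monomial ((-1) ^+ N / N.+1%:R * cos (N.+1%:R * t)) N s.
  congr is_derive; field.
  by rewrite nat1r pnatr_eq0.
have := is_deriveD IH dt; congr is_derive.
apply/funext => x; rewrite /fourier_sum big_ord_recr/=; congr (_ + _); ring.
Qed.

(** The sum is the real part of a geometric series of ratio [- s * exp (i t)], the right side is its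
    tail, and the denominator is [|1 + s * exp (i t)| ^ 2]. The induction stays real thanks to
    [cos_rec]. *)
Lemma fourier_remainder_derive (N : nat) s t :
  1 + s ^+ 2 + 2 * s * cos t != 0 ->
  (s + cos t) / (1 + s ^+ 2 + 2 * s * cos t)
    - \sum_(n < N) (-1) ^+ n * s ^+ n * cos (n.+1%:R * t) =
  (-1) ^+ N * s ^+ N * (cos (N.+1%:R * t) + s * cos (N%:R * t))
    / (1 + s ^+ 2 + 2 * s * cos t).
Proof.
move=> D0; elim: N => [|N IH].
  by rewrite big_ord0 subr0 !expr0 !mul0r !mul1r cos0 mulr1 addrC.
rewrite big_ord_recr/= opprD addrA IH cos_rec; apply: (mulIf D0).
rewrite mulrBl !divfK// !exprS; ring.
Qed.

(* Differentiating in [r] turns the remainder into a geometric one. *)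
Lemma fourier_approx (N : nat) (C r t : R) : 0 <= r <= 1 ->
  (forall s, 0 <= s <= r -> 1 <= C * (1 + s ^+ 2 + 2 * s * cos t)) ->
  `|ln (1 + r ^+ 2 + 2 * r * cos t) / 2 - fourier_sum N r t| <=
  2 * C / N.+1%:R.
Proof.
move=> /andP[r0 r1] hC.
have C0 : 0 <= C by have := hC 0; rewrite lexx r0 => /(_ isT); rewrite expr0n/=; lra.
have D0 s : 0 <= s <= r -> 0 < 1 + s ^+ 2 + 2 * s * cos t.
  by move=> /hC h; rewrite ltNge; apply/negP => h1; nra.
pose E s := ln (1 + s ^+ 2 + 2 * s * cos t) / 2 - fourier_sum N s t.
(* Primitive of the bound [2 * C * s ^+ N]: the cosines in the remainder contribute at most [2], and
   [C] bounds the inverse of the denominator. Integrating [s ^+ N] yields decay in [N] even at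
   [r = 1]. *)
pose g s := 2 * C / N.+1%:R * s ^+ N.+1.
have E0 : E 0 = 0.
  rewrite /E expr0n/= mulr0 mul0r !addr0 ln1 mul0r sub0r /fourier_sum.
  by rewrite big1 ?oppr0// => i _; rewrite expr0n/= mulr0 !mul0r.
have -> : ln (1 + r ^+ 2 + 2 * r * cos t) / 2 - fourier_sum N r t = E r - E 0.
  by rewrite E0 subr0.
have gle : g r - g 0 <= 2 * C / N.+1%:R.
  rewrite /g expr0n/= mulr0 subr0 ler_piMr//; last exact: exprn_ile1.
  by rewrite divr_ge0// mulr_ge0.
apply: le_trans gle.
pose E1 s := (s + cos t) / (1 + s ^+ 2 + 2 * s * cos t)
    - \sum_(n < N) (-1) ^+ n * s ^+ n * cos (n.+1%:R * t).
pose g1 s := 2 * C * s ^+ N.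
suff [dE dg le1] : [/\ forall s, 0 <= s <= r -> is_derive s (1 : R) E (E1 s),
    forall s, 0 <= s <= r -> is_derive s (1 : R) g (g1 s) &
    forall s, 0 <= s <= r -> `|E1 s| <= g1 s].
  by move: (E) (g) (E1) (g1) dE dg le1 => ? ? ? ?; exact: derive_comparison.
split=> s sr.
- have Ds := D0 s sr.
  have dD : is_derive s (1 : R) (fun s => 1 + s ^+ 2 + 2 * s * cos t)
     (2 * (s + cos t)).
    by apply: is_derive_eq; rewrite /GRing.scale/=; ring.
  have dl := is_derive1_ln Ds.
  have dc := @is_derive1_comp R (@ln R) (fun s => 1 + s ^+ 2 + 2 * s * cos t) s _ _ dl dD.
  have dh : is_derive s (1 : R) (fun s => 2^-1 * ln (1 + s ^+ 2 + 2 * s * cos t))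
      ((s + cos t) / (1 + s ^+ 2 + 2 * s * cos t)).
    have := is_deriveZ 2^-1 dc; congr is_derive.
    by rewrite /GRing.scale/=; field; rewrite gt_eqF.
  have := is_deriveB dh (is_derive_fourier_sum N s t); congr is_derive.
  by apply/funext => x /=; rewrite /E mulrC.
- have := is_derive_monomial (2 * C / N.+1%:R) N s; congr is_derive; rewrite /g1; field.
  by rewrite nat1r pnatr_eq0.
- have Ds := D0 s sr; rewrite /E1 /g1 fourier_remainder_derive ?gt_eqF//.
  move: sr (hC s sr) => /andP[s0 sr] hs.
  rewrite !normrM normrX normrN1 expr1n mul1r normfV (gtr0_norm Ds).
  rewrite ler_pdivrMr// ger0_norm ?exprn_ge0//.
  have c2 : `|cos (N.+1%:R * t) + s * cos (N%:R * t)| <= 2.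
    apply: le_trans (ler_normD _ _) _; rewrite normrM.
    have := cos_max (N.+1%:R * t); have := cos_max (N%:R * t).
    rewrite (ger0_norm s0); have := normr_ge0 (cos (N%:R * t)).
    by move=> ? ? ?; nra.
  have sN : 0 <= s ^+ N by rewrite exprn_ge0.
  by nra.
Qed.

End Fourier.

(** * The mean over [y] when [r < 1] *)

Section Inner.
Context (R : realType).
Implicit Types (r s t c x : R).
Notation mu := (@lebesgue_measure R).

(** Turns an error of order [1 / N] into an exact identity; [n0] skips the short partial sums that
    miss the term of frequency [2]. *)
Lemma small_eq0 (K x : R) (n0 : nat) :
  (forall N, (n0 <= N)%N -> `|x| <= K / N.+1%:R) -> x = 0.
Proof.
move=> h; apply/eqP; rewrite -normr_eq0; apply/negPn/negP => x0.
have {}x0 : 0 < `|x| by rewrite lt_def x0 normr_ge0.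
pose N := maxn n0 (Num.bound (`|K| / `|x|)).
have := h N (leq_maxl _ _); apply/negP; rewrite -ltNge.
rewrite ltr_pdivrMr// mulrC -ltr_pdivrMr//.
apply: le_lt_trans (_ : _ <= `|K| / `|x|) _; first by rewrite ler_pM2r ?invr_gt0// ler_norm.
apply: lt_trans (archi_boundP _) _; first by rewrite divr_ge0.
by rewrite ltr_nat ltnS leq_maxr.
Qed.

Lemma sin_natpi (n : nat) : sin (n%:R * pi) = 0 :> R.
Proof.
elim: n => [|n IH]; first by rewrite mul0r sin0.
by rewrite -natr1 mulrDl mul1r sinDpi IH oppr0.
Qed.

Lemma cosX_sin2 (k : R) t :
  cos (k * t) * sin t ^+ 2 =
  cos (k * t) / 2 - cos ((k + 2) * t) / 4 - cos ((k - 2) * t) / 4.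
Proof.
have -> : (k + 2) * t = k * t + t *+ 2 by rewrite -mulr_natl; ring.
have -> : (k - 2) * t = k * t - t *+ 2 by rewrite -mulr_natl; ring.
rewrite cosD cosB cos_mulr2n.
by rewrite sin2cos2; field.
Qed.

(* Antiderivatives of [cos ((n + 1) t) sin t ^ 2]; the index [n = 1] is the only
   one with a secular term. *)
Definition int_cos_sin2 (n : nat) t : R :=
  match n with
  | 0 => sin t ^+ 3 / 3
  | 1 => sin (2 * t) / 4 - sin (4 * t) / 16 - t / 4
  | j.+2 => sin (j.+3%:R * t) / (2 * j.+3%:R) - sin (j.+4.+1%:R * t) / (4 * j.+4.+1%:R)
      - sin (j.+1%:R * t) / (4 * j.+1%:R)
  end.

Lemma is_derive_sinM (k : R) t : is_derive t (1 : R) (fun t => sin (k * t)) (k * cos (k * t)).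
Proof.
have dk : is_derive t (1 : R) (fun t => k * t) k.
  by apply: is_derive_eq; rewrite /GRing.scale/= mulr1.
have := @is_derive1_comp R (@sin R) (fun t => k * t) t _ _ (is_derive_sin _) dk.
by rewrite mulrC.
Qed.

Lemma is_derive_sinMZ (k c : R) t : k != 0 ->
  is_derive t (1 : R) (fun t => sin (k * t) / (c * k)) (cos (k * t) / c).
Proof.
move=> k0; have := is_deriveZ (c * k)^-1 (is_derive_sinM k t); congr is_derive.
  by apply/funext => x; exact: mulrC.
by rewrite /GRing.scale/= invfM -!mulrA (mulrA k^-1) mulVf// mul1r mulrC.
Qed.

Lemma is_derive_int_cos_sin2 (n : nat) t :
  is_derive t (1 : R) (int_cos_sin2 n) (cos (n.+1%:R * t) * sin t ^+ 2).
Proof.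
case: n => [|[|j]].
- have := is_deriveZ (3^-1) (is_deriveX 3 (is_derive_sin t)); congr is_derive.
    by apply/funext => x; rewrite exprfctE; exact: mulrC.
  by rewrite /GRing.scale/= mul1r; field.
- rewrite cosX_sin2 (_ : 2%:R - 2 = 0 :> R) ?subrr// mul0r cos0.
  have n0 (m : nat) : m.+1%:R != 0 :> R by rewrite pnatr_eq0.
  have d2 := is_derive_sinMZ 2 t (n0 1%N).
  have d4 := is_derive_sinMZ 4 t (n0 3%N).
  have dt : is_derive t (1 : R) (fun t => t / 4) (4^-1).
    have := is_deriveZ 4^-1 (is_derive_id t (1 : R)); congr is_derive.
      by apply/funext => x; exact: mulrC.
    by rewrite /GRing.scale/= mulr1.
  have := is_deriveB (is_deriveB d2 d4) dt; congr is_derive.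
    by apply/funext => x /=; rewrite /int_cos_sin2; congr (_ / _ - _ / _ - _); ring.
  by rewrite mul1r; congr (_ - cos (_ * _) / _ - _); ring.
- rewrite cosX_sin2.
  have n0 (m : nat) : m.+1%:R != 0 :> R by rewrite pnatr_eq0.
  have d1 := is_derive_sinMZ 2 t (n0 j.+2).
  have d2 := is_derive_sinMZ 4 t (n0 j.+4).
  have d3 := is_derive_sinMZ 4 t (n0 j).
  have := is_deriveB (is_deriveB d1 d2) d3; congr is_derive.
  have -> : j.+3%:R + 2 = j.+4.+1%:R :> R by rewrite -natrD addn2.
  by have -> : j.+3%:R - 2 = j.+1%:R :> R by rewrite -(addn2 j.+1) natrD addrK.
Qed.

Lemma int_cos_sin2_pi (n : nat) : int_cos_sin2 n pi - int_cos_sin2 n 0 = if n == 1%N then - (pi / 4) else 0.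
Proof.
case: n => [|[|j]] /=.
- by rewrite sinpi sin0 subrr.
- rewrite !mulr0 sin0 !(sin_natpi 2) !(sin_natpi 4) !mul0r; ring.
- by rewrite !sin_natpi !mulr0 sin0 !mul0r !subr0.
Qed.

Definition int_sum (N : nat) r t : R :=
  \sum_(n < N) (-1) ^+ n * r ^+ n.+1 / n.+1%:R * int_cos_sin2 n t.

Lemma is_derive_int_sum (N : nat) r t :
  is_derive t (1 : R) (int_sum N r) (fourier_sum N r t * sin t ^+ 2).
Proof.
elim: N => [|N IH].
  rewrite /fourier_sum big_ord0 mul0r (_ : int_sum 0 r = cst 0); first exact: is_derive_cst.
  by apply/funext => x; rewrite /int_sum big_ord0.
rewrite /fourier_sum big_ord_recr/= -/(fourier_sum N r t) mulrDl -mulrA.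
have := is_deriveD IH (is_deriveZ ((-1) ^+ N * r ^+ N.+1 / N.+1%:R) (is_derive_int_cos_sin2 N t)).
congr is_derive; first by apply/funext => x; rewrite /int_sum big_ord_recr.
by rewrite /GRing.scale/= !mulrA.
Qed.

(** Only index [1], of frequency [2], survives: its coefficient [- r ^+ 2 / 2] multiplies
    [- pi / 4]. The condition on [N] ensures that this index is present. *)
Lemma int_sum_pi (N : nat) r : (2 <= N)%N ->
  int_sum N r pi - int_sum N r 0 = pi * r ^+ 2 / 8.
Proof.
case: N => [|[|N]]// _.
rewrite /int_sum -sumrB.
under eq_bigr do rewrite -mulrBr int_cos_sin2_pi.
rewrite !big_ord_recl/= big1 ?addr0; last by move=> i _; rewrite mulr0.
rewrite mulr0 add0r /bump/= ?addn0 ?add1n; move: (@pi R) => p.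
  by field.
Qed.

Lemma poisson_lower r s t : 0 <= s <= r -> r < 1 ->
  (1 - r) ^+ 2 <= 1 + s ^+ 2 + 2 * s * cos t.
Proof.
move=> /andP[s0 sr] r1; have := cos_geN1 t => c1.
apply: (@le_trans _ _ ((1 - s) ^+ 2)); first by rewrite ler_sqr ?nnegrE; lra.
by nra.
Qed.

(** Since [r < 1] keeps the argument of the logarithm above [(1 - r) ^+ 2], the truncation error is
    of order [1 / N] uniformly in [t], and [sin t ^+ 2 <= 1] preserves this. The increment of [P]
    stands for the integral. *)
Lemma log_sin2_small r (P : R -> R) : 0 <= r < 1 ->
  (forall t, 0 <= t <= pi ->
    is_derive t (1 : R) P (ln (1 + r ^+ 2 + 2 * r * cos t) / 2 * sin t ^+ 2)) ->
  P pi - P 0 = pi * r ^+ 2 / 8.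
Proof.
move=> /andP[r0 r1] dP; apply/eqP; rewrite -subr_eq0; apply/eqP.
pose C := ((1 - r) ^+ 2)^-1.
have C0 : 0 < (1 - r) ^+ 2 by rewrite exprn_gt0// subr_gt0.
apply: (@small_eq0 (2 * C * pi) _ 2) => N N2.
rewrite -(int_sum_pi r N2).
have -> : P pi - P 0 - (int_sum N r pi - int_sum N r 0) =
    (P - int_sum N r) pi - (P - int_sum N r) 0 by rewrite -[(P - _) pi]/(P pi - _) -[(P - _) 0]/(P 0 - _); ring.
have -> : 2 * C * pi / N.+1%:R = 2 * C / N.+1%:R * pi - 2 * C / N.+1%:R * 0 by ring.
apply: (@derive_comparison _ _ (fun t => 2 * C / N.+1%:R * t)
  (fun t => ln (1 + r ^+ 2 + 2 * r * cos t) / 2 * sin t ^+ 2 -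
            fourier_sum N r t * sin t ^+ 2) (cst (2 * C / N.+1%:R))).
- exact: pi_ge0.
- by move=> t tpi; have d1 := dP t tpi; exact: (is_deriveB d1 (is_derive_int_sum N r t)).
- by move=> t _; apply: is_derive_eq; rewrite /GRing.scale/= mulr1.
- move=> t _; rewrite -mulrBl normrM -[leRHS]mulr1; apply: ler_pM => //.
    apply: fourier_approx; first by rewrite r0 ltW.
    by move=> s sr; rewrite /C mulrC ler_pdivlMr// mul1r; exact: poisson_lower.
  by rewrite normrX expr_le1// sin_max.
Qed.

End Inner.

(** * The L-value at the angle [2 * pi / 3] *)

Section Outer.
Context (R : realType).
Implicit Types (r s t c x : R).
Notation mu := (@lebesgue_measure R).

Definition two_pi3 : R := 2 * pi / 3.

Lemma two_pi3_bounds : 0 < two_pi3 < pi.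
Proof. by rewrite /two_pi3; have := pi_gt0 R; move: (@pi R) => p p0; apply/andP; split; lra. Qed.

(** With [c] the cosine, tripling the angle gives [4 c^3 - 3 c - 1 = 0], which factors as
    [(c - 1) (2 c + 1)^2 = 0]; the positive sine rules out [c = 1]. *)
Lemma cos_two_pi3 : cos two_pi3 = - 2^-1.
Proof.
have s0 : 0 < sin two_pi3 by exact: sin_gt0_pi two_pi3_bounds.
have e3 : cos (two_pi3 *+ 2 + two_pi3) = 1.
  rewrite (_ : two_pi3 *+ 2 + two_pi3 = pi *+ 2) ?cos2pi//.
  by rewrite /two_pi3 !mulr2n; move: (@pi R) => p; field.
rewrite cosD cos_mulr2n sin_mulr2n in e3.
have e := cos2Dsin2 two_pi3.
have c1 : cos two_pi3 != 1 by apply/eqP => c1; rewrite c1 in e; nra.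
have : (cos two_pi3 - 1) * (2 * cos two_pi3 + 1) ^+ 2 = 0.
  have -> : (cos two_pi3 - 1) * (2 * cos two_pi3 + 1) ^+ 2 = 4 * cos two_pi3 ^+ 3 - 3 * cos two_pi3 - 1 by ring.
  have s2 : sin two_pi3 ^+ 2 = 1 - cos two_pi3 ^+ 2 by lra.
  rewrite -[in X in _ - X]e3 !mulr2n.
  transitivity (4 * cos two_pi3 ^+ 3 - 3 * cos two_pi3 -
    (cos two_pi3 * (2 * cos two_pi3 ^+ 2 - 1) - 2 * cos two_pi3 * sin two_pi3 ^+ 2)); first by ring.
  by rewrite s2; ring.
move=> /eqP; rewrite mulf_eq0 subr_eq0 (negbTE c1)/= sqrf_eq0 => /eqP h; lra.
Qed.

Lemma sin_two_pi3 : sin two_pi3 = Num.sqrt 3 / 2.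
Proof.
have s0 : 0 < sin two_pi3 by exact: sin_gt0_pi two_pi3_bounds.
have e := cos2Dsin2 two_pi3; rewrite cos_two_pi3 in e.
have s2 : sin two_pi3 ^+ 2 = 3 / 2 ^+ 2 by lra.
by rewrite -[LHS]ger0_norm ?ltW// -sqrtr_sqr s2 sqrtrM// sqrtrV ?exprn_ge0// sqrtr_sqr ger0_norm.
Qed.

(** The character enters here: the left side is odd and of period [3] in [n], hence a multiple of
    [chi3]. *)
Lemma sin_nat_two_pi3 (n : nat) : sin (n%:R * two_pi3) = Num.sqrt 3 / 2 * chi3 R n.
Proof.
elim/ltn_ind: n => n IH.
case: n IH => [|[|[|n]]] IH.
- by rewrite mul0r sin0 /chi3/= mulr0.
- by rewrite mul1r sin_two_pi3 /chi3/= mulr1.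
- rewrite mulr_natl sin_mulr2n cos_two_pi3 sin_two_pi3 /chi3/= mulr2n; by field.
- have -> : n.+3%:R * two_pi3 = n%:R * two_pi3 + pi *+ 2.
    rewrite -(addn3 n) natrD mulrDl; congr (_ + _).
    by rewrite /two_pi3 mulr2n; move: (@pi R) => p; field.
  rewrite sinD2pi IH; last by rewrite ltnS ltnW.
  by rewrite /chi3 -(addn3 n) modnDr.
Qed.

Definition Lchi3_partial (N : nat) : R := \sum_(n < N) chi3 R n.+1 / n.+1%:R ^+ 2.

Lemma chi3_double (n : nat) : chi3 R n.*2 = - chi3 R n.
Proof.
rewrite /chi3 -muln2 -modnMml.
by have := ltn_pmod n (isT : 0 < 3)%N; case: (n %% 3)%N => [|[|[|]]]//= _; rewrite ?oppr0 ?opprK.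
Qed.

(** Flipping the signs at even integers subtracts twice the even terms. By [chi3_double] the term at
    [2 m] is minus a quarter of the term at [m], so half of the shorter sum is added. In the limit
    this gives [3 / 2] times the L-value. *)
Lemma alternating_Lchi3_partial (M : nat) :
  \sum_(n < M.*2) (-1) ^+ n * (chi3 R n.+1 / n.+1%:R ^+ 2) = Lchi3_partial M.*2 + Lchi3_partial M / 2.
Proof.
elim: M => [|M IH]; first by rewrite /Lchi3_partial !big_ord0 mul0r addr0.
rewrite doubleS !big_ord_recr/= IH /Lchi3_partial !big_ord_recr/=.
rewrite -signr_odd -[in X in _ + X * _]signr_odd /= odd_double/= expr0 mul1r expr1.
rewrite -doubleS chi3_double -[in X in _ = _ + X]/(Lchi3_partial M).
have -> : (M.+1.*2)%:R = 2 * M.+1%:R :> R by rewrite -muln2 natrM mulrC.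
rewrite -/(Lchi3_partial _) -/(Lchi3_partial _).
have m0 : M.+1%:R != 0 :> R by rewrite pnatr_eq0.
have m1 : (M.*2).+1%:R != 0 :> R by rewrite pnatr_eq0.
move: (M.+1%:R : R) m0 ((M.*2).+1%:R : R) m1 => m m0 m' m'0.
by field; rewrite m0.
Qed.

(** Absolute convergence, by comparison with a telescoping series of partial sums
    [2 - 2 / (N + 1)]. *)
Lemma is_cvg_Lchi3_partial : cvgn Lchi3_partial.
Proof.
have -> : Lchi3_partial = series (fun n => chi3 R n.+1 / n.+1%:R ^+ 2).
  by apply/funext => N; rewrite /series/= big_mkord.
apply: normed_cvg.
apply: (@series_le_cvg _ _ (fun n => 2 / (n.+1%:R * n.+2%:R))) => [n|n|n|].
- exact: normr_ge0.
- by rewrite divr_ge0// mulr_ge0.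
- have n0 : 0 < n.+1%:R :> R by rewrite ltr0n.
  have n1 : 0 < n.+2%:R :> R by rewrite ltr0n.
  have c1 : `|chi3 R n.+1| <= 1.
    by rewrite /chi3; case: ifP => _; [rewrite normr1|case: ifP => _; rewrite ?normrN1 ?normr0].
  rewrite /= normrM normfV (ger0_norm (exprn_ge0 _ (ltW n0))).
  apply: le_trans (ler_wpM2r _ c1) _; first by rewrite invr_ge0 exprn_ge0// ltW.
  rewrite mul1r -[leLHS]mul1r ler_pdivrMr ?exprn_gt0// mulrAC ler_pdivlMr ?mulr_gt0//.
  have e : n.+2%:R = n.+1%:R + 1 :> R by rewrite natr1.
  have x1 : 1 <= n.+1%:R :> R by rewrite ler1n.
  by rewrite mul1r e; nra.
- have -> : series (fun n : nat => 2 / (n.+1%:R * n.+2%:R)) = (fun N => 2 - 2 / N.+1%:R :> R).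
    apply/funext => N; rewrite /series/=; elim: N => [|N IH].
      by rewrite big_nil divr1 subrr.
    rewrite big_nat_recr//= IH -[N.+2%:R]natr1.
    have n0 : 0 < N.+1%:R :> R by rewrite ltr0n.
    by field; rewrite !gt_eqF// ltr_wpDl// ltW.
  apply: is_cvgB; first exact: is_cvg_cst.
  apply: is_cvgM; first exact: is_cvg_cst.
  apply/cvg_ex; exists 0; exact: cvg_harmonic.
Qed.

(** The sequence defining [Lchi3_2] stops at [n < N], one term before [Lchi3_partial N], hence the
    shift. *)
Lemma Lchi3_partial_cvg : Lchi3_partial @ \oo --> Lchi3_2 R.
Proof.
have h := is_cvg_Lchi3_partial; suff -> : Lchi3_2 R = limn Lchi3_partial by [].
rewrite /Lchi3_2.
have : (fun N : nat => \sum_(1 <= n < N.+1) chi3 R n / n%:R ^+ 2) @ \oo --> limn Lchi3_partial.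
  rewrite (_ : (fun N : nat => _) = Lchi3_partial)//.
  by apply/funext => N; rewrite big_add1/= big_mkord.
by rewrite (cvg_shiftS (fun N : nat => \sum_(1 <= n < N) chi3 R n / n%:R ^+ 2)) => /cvg_lim; apply.
Qed.

Lemma cvg_double : double @ \oo --> \oo.
Proof.
apply/cvgnyPge => A; near=> n.
rewrite -addnn (leq_trans _ (leq_addr _ _))//; near: n; exact: nbhs_infty_ge.
Unshelve. all: by end_near. Qed.

Lemma log_two_pi3 (P : R -> R) :
  (forall t, 0 <= t <= two_pi3 -> is_derive t (1 : R) P (ln (1 + 1 ^+ 2 + 2 * 1 * cos t) / 2)) ->
  P two_pi3 - P 0 = 3 * Num.sqrt 3 / 4 * Lchi3_2 R.
Proof.
move=> dP; have /andP[b0 bpi] := two_pi3_bounds.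
pose SS (N : nat) t := \sum_(n < N) ((-1) ^+ n / n.+1%:R) * (sin (n.+1%:R * t) / (1 * n.+1%:R)).
have dS N t : is_derive t (1 : R) (SS N) (fourier_sum N 1 t).
  elim: N => [|N IH].
    rewrite /fourier_sum big_ord0 (_ : SS 0%N = cst 0); first exact: is_derive_cst.
    by apply/funext => x; rewrite /SS big_ord0.
  rewrite /fourier_sum big_ord_recr/= -/(fourier_sum N 1 t).
  have n0 : N.+1%:R != 0 :> R by rewrite pnatr_eq0.
  have := is_deriveD IH (is_deriveZ ((-1) ^+ N / N.+1%:R) (is_derive_sinMZ 1 t n0)).
  congr is_derive; first by apply/funext => x; rewrite /SS big_ord_recr.
  by rewrite /GRing.scale/= expr1n mulr1 divr1.
have SSE M : SS M.*2 two_pi3 - SS M.*2 0 = Num.sqrt 3 / 2 * (Lchi3_partial M.*2 + Lchi3_partial M / 2).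
  rewrite -alternating_Lchi3_partial mulr_sumr /SS -sumrB; apply: eq_bigr => n _.
  rewrite mulr0 sin0 mul0r mulr0 subr0 sin_nat_two_pi3 mul1r.
  by field; rewrite nat1r pnatr_eq0.
(* [4 / 3] is the inverse of [3 / 4], the minimum of [1 - s + s ^+ 2], which bounds the denominator
   from below once [cos t >= - 1 / 2]. This makes the series usable at [r = 1]. *)
pose K := 2 * (4 / 3) * two_pi3 : R.
have err N : `|P two_pi3 - P 0 - (SS N two_pi3 - SS N 0)| <= K / N.+1%:R.
  have -> : P two_pi3 - P 0 - (SS N two_pi3 - SS N 0) = (P - SS N) two_pi3 - (P - SS N) 0.
    by rewrite -[(P - _) two_pi3]/(P two_pi3 - _) -[(P - _) 0]/(P 0 - _); ring.
  have -> : K / N.+1%:R = 2 * (4 / 3) / N.+1%:R * two_pi3 - 2 * (4 / 3) / N.+1%:R * 0.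
    by rewrite /K; ring.
  apply: (@derive_comparison _ _ (fun t => 2 * (4 / 3) / N.+1%:R * t)
    (fun t => ln (1 + 1 ^+ 2 + 2 * 1 * cos t) / 2 - fourier_sum N 1 t)
    (cst (2 * (4 / 3) / N.+1%:R))).
  - exact: ltW.
  - by move=> t tb; have d1 := dP t tb; exact: (is_deriveB d1 (dS N t)).
  - by move=> t _; apply: is_derive_eq; rewrite /GRing.scale/= mulr1.
  - move=> t /andP[t0 tb]; apply: fourier_approx; first by rewrite ler01 lexx.
    move=> s /andP[s0 s1].
    have ct : - 2^-1 <= cos t.
      have tI : t \in `[0, pi] by rewrite in_itv/= t0 (le_trans tb) ?ltW.
      have bI : two_pi3 \in `[0, pi] by rewrite in_itv/= !ltW.
      by rewrite -cos_two_pi3 leNgt ltr_cos// -leNgt.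
    have h1 : 0 <= s * (cos t + 2^-1) by rewrite mulr_ge0//; lra.
    by have h2 := sqr_ge0 (s - 2^-1); nra.
(* Even partial sums suffice to determine the limit, and they have the closed form [SSE]. *)
have cT : (fun M => SS M.*2 two_pi3 - SS M.*2 0) @ \oo --> P two_pi3 - P 0.
  have cd : (fun M : nat => K / (M.*2).+1%:R) @ \oo --> (0 : R).
    rewrite -[X in _ --> X](mulr0 K); apply: cvgM; first exact: cvg_cst.
    exact: (cvg_comp _ _ cvg_double cvg_harmonic).
  apply/cvgrPdist_le => e e0.
  have /cvgrPdist_le/(_ e e0) := cd.
  apply: filterS => M; rewrite sub0r normrN => h.
  apply: le_trans h; apply: le_trans (err _) _; exact: ler_norm.
have cT2 : (fun M => SS M.*2 two_pi3 - SS M.*2 0) @ \oo -->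
    Num.sqrt 3 / 2 * (Lchi3_2 R + Lchi3_2 R / 2).
  under eq_fun do rewrite SSE.
  apply: cvgM; first exact: cvg_cst.
  apply: cvgD; last by apply: cvgM; [exact: Lchi3_partial_cvg|exact: cvg_cst].
  exact: (cvg_comp _ _ cvg_double Lchi3_partial_cvg).
have := cvg_unique _ cT cT2.
by move=> ->//; field.
Qed.

End Outer.

(** * Evaluation of the inner and outer integrals *)

Section Definite.
Context (R : realType).
Implicit Types (r s t c x q : R).
Notation mu := (@lebesgue_measure R).

Lemma eq_derive_increment (f g f1 : R -> R) (a b : R) : a <= b ->
  (forall x, a <= x <= b -> is_derive x (1 : R) f (f1 x)) ->
  (forall x, a <= x <= b -> is_derive x (1 : R) g (f1 x)) ->
  f b - f a = g b - g a.
Proof.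
move=> ab df dg; apply/eqP; rewrite -subr_eq0 -normr_le0.
have -> : f b - f a - (g b - g a) = (f - g) b - (f - g) a.
  by rewrite -[(f - g) b]/(f b - g b) -[(f - g) a]/(f a - g a); ring.
have -> : 0 = cst 0 b - cst 0 a :> R by rewrite subrr.
apply: (@derive_comparison R (f - g) (cst 0) (fun x => f1 x - f1 x) (cst 0)) => // x xab.
- by have d1 := df x xab; have d2 := dg x xab; exact: (is_deriveB d1 d2).
- by rewrite subrr normr0.
Qed.

Lemma is_derive_sin2 t : is_derive t (1 : R) (fun t => (t - sin t * cos t) / 2) (sin t ^+ 2).
Proof.
apply: is_derive_eq; rewrite /GRing.scale/=.
by have := cos2Dsin2 t => e; lra.
Qed.

(** The variable is [q = r ^+ 2]. With [Num.min] and [Num.max] both regimes share one formula,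
    visibly continuous at [q = 1]; [- 4^-1] cancels what the inactive part contributes. *)
Definition sphere_log_mean q : R :=
  Num.min q 1 / 4 + ln (Num.max q 1) / 2 + (4 * Num.max q 1)^-1 - 4^-1.

Lemma sphere_log_mean_le1 q : q <= 1 -> sphere_log_mean q = q / 4.
Proof. by move=> q1; rewrite /sphere_log_mean min_l// max_r// ln1 mulr1; ring. Qed.

Lemma sphere_log_mean_ge1 q : 1 <= q -> sphere_log_mean q = ln q / 2 + (4 * q)^-1.
Proof. by move=> q1; rewrite /sphere_log_mean min_r// max_l//; ring. Qed.

Lemma ln3_ge : ln 2 + 3^-1 <= ln 3 :> R.
Proof.
have h : ln (1 + - 3^-1) <= - 3^-1 :> R by apply: le_ln1Dx; lra.
have e : ln 2 = ln 3 + ln (1 + - 3^-1) :> R.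
  by rewrite -lnM ?posrE; [congr ln; field|lra|lra].
lra.
Qed.

Lemma ln2_ge0 : 0 <= ln 2 :> R. Proof. by apply: ln_ge0; lra. Qed.

(** The mean is at most [ln 2 + 1 / 4], within reach of [ln3_ge]. For [q = |1 + x| ^ 2] this is the
    nonnegativity of the outer integrand that the sphere formula asks for. *)
Lemma sphere_log_mean_le q : q <= 4 -> sphere_log_mean q <= ln 3.
Proof.
move=> q4; have h3 := ln3_ge; have h2 := ln2_ge0.
have [q1|/ltW q1] := leP q 1; first by rewrite sphere_log_mean_le1//; lra.
rewrite sphere_log_mean_ge1//.
have lq : ln q <= ln (2 ^+ 2) by rewrite ler_ln ?posrE//; [rewrite expr2; lra|lra].
rewrite lnXn// mulr2n in lq.
have : (4 * q)^-1 <= 4^-1 by rewrite lef_pV2 ?posrE; lra.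
by lra.
Qed.

Lemma max_normE q : Num.max q 1 = (q + 1 + `|q - 1|) / 2.
Proof.
by have [h|h] := leP q 1; [rewrite ler0_norm|rewrite gtr0_norm]; lra.
Qed.

Lemma min_normE q : Num.min q 1 = (q + 1 - `|q - 1|) / 2.
Proof.
by have [h|h] := leP q 1; [rewrite ler0_norm|rewrite gtr0_norm]; lra.
Qed.

Lemma continuous_max1 (f : R -> R) : continuous f -> continuous (fun x => Num.max (f x) 1).
Proof.
move=> cf; under eq_fun do rewrite max_normE.
move=> x; apply: cvgMl.
apply: cvgD; first by apply: cvgD; [exact: cf|exact: cvg_cst].
by apply: cvg_norm; apply: cvgB; [exact: cf|exact: cvg_cst].
Qed.

Lemma continuous_min1 (f : R -> R) : continuous f -> continuous (fun x => Num.min (f x) 1).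
Proof.
move=> cf; under eq_fun do rewrite min_normE.
move=> x; apply: cvgMl.
apply: cvgB; first by apply: cvgD; [exact: cf|exact: cvg_cst].
by apply: cvg_norm; apply: cvgB; [exact: cf|exact: cvg_cst].
Qed.

Lemma continuous_ln_max1 (f : R -> R) : continuous f ->
  continuous (fun x => ln (Num.max (f x) 1)).
Proof.
move=> cf x; apply: (@continuous_comp _ _ _ (fun x => Num.max (f x) 1) (@ln R)).
  exact: continuous_max1.
by apply: continuous_ln; rewrite lt_max ltr01 orbT.
Qed.

Lemma continuous_sphere_log_mean (f : R -> R) : continuous f -> continuous (fun x => sphere_log_mean (f x)).
Proof.
move=> cf x; rewrite /sphere_log_mean; apply: cvgB; last exact: cvg_cst.
apply: cvgD; last first.
  apply: cvgV; first by rewrite mulf_neq0// gt_eqF// lt_max ltr01 orbT.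
  by apply: cvgM; [exact: cvg_cst|exact: continuous_max1].
apply: cvgD; last by apply: cvgMl; exact: continuous_ln_max1.
by apply: cvgMl; exact: continuous_min1.
Qed.

Lemma poisson_gt0 r t : r != 1 -> 0 <= r -> 0 < 1 + r ^+ 2 + 2 * r * cos t.
Proof.
move=> r1 r0; have c1 := cos_geN1 t.
have : 0 < (1 - r) ^+ 2 by rewrite lt_def sqr_ge0 sqrf_eq0 subr_eq0 eq_sym r1.
by nra.
Qed.

(** For [r > 1], factoring [r ^+ 2] out of the logarithm leaves the case [r^-1] plus [ln r], whose
    integral against [sin t ^+ 2] is [pi / 2 * ln r]. *)
Lemma log_sin2 r (P : R -> R) : 0 <= r -> r != 1 ->
  (forall t, 0 <= t <= pi ->
    is_derive t (1 : R) P (ln (1 + r ^+ 2 + 2 * r * cos t) / 2 * sin t ^+ 2)) ->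
  P pi - P 0 = pi / 2 * sphere_log_mean (r ^+ 2).
Proof.
move=> r0; rewrite neq_lt => /orP[r1|r1] dP.
  rewrite (@log_sin2_small _ r)// ?r0// sphere_log_mean_le1; last by rewrite exprn_ile1// ltW.
  by move: (@pi R) => p; field.
have ri : 0 <= r^-1 < 1 by rewrite invr_ge0 r0 invf_lt1// (lt_trans ltr01).
have r0' : r != 0 by rewrite gt_eqF// (lt_trans ltr01).
have dQ t : 0 <= t <= pi -> is_derive t (1 : R)
    (P - (ln r \*: (fun t => (t - sin t * cos t) / 2)))
    (ln (1 + r^-1 ^+ 2 + 2 * r^-1 * cos t) / 2 * sin t ^+ 2).
  move=> tpi; have := is_deriveB (dP t tpi) (is_deriveZ (ln r) (is_derive_sin2 t)).
  congr is_derive; rewrite /GRing.scale/= -mulrBl; congr (_ * _).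
  have -> : 1 + r ^+ 2 + 2 * r * cos t = r ^+ 2 * (1 + r^-1 ^+ 2 + 2 * r^-1 * cos t).
    by field.
  have r00 : 0 < r by exact: lt_trans r1.
  have /andP[ri0 ri1] := ri.
  have p2 : 0 < 1 + r^-1 ^+ 2 + 2 * r^-1 * cos t by apply: poisson_gt0; rewrite ?lt_eqF.
  rewrite lnM ?posrE ?exprn_gt0// lnXn// mulr2n; by field.
have := log_sin2_small ri dQ.
rewrite -[(P - _) pi]/(P pi - ln r * ((pi - sin pi * cos pi) / 2)).
rewrite -[(P - _) 0]/(P 0 - ln r * ((0 - sin 0 * cos 0) / 2)).
rewrite sinpi sin0 !mul0r !subr0 mul0r mulr0 subr0 => e.
rewrite sphere_log_mean_ge1 ?exprn_ege1 ?ltW//.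
have -> : P pi - P 0 = pi * r^-1 ^+ 2 / 8 + ln r * (pi / 2) by rewrite -e; ring.
rewrite lnXn ?(lt_trans ltr01)// mulr2n.
by move: (@pi R) => p; field.
Qed.

Lemma pi_lt4 : pi < 4 :> R.
Proof. by have := pihalf_lt2 R; lra. Qed.

Lemma inner_integral r : 0 <= r -> r != 1 ->
  (\int[mu]_(t in `[0%R, (pi : R)])
     ((ln 3 - ln (1 + r ^+ 2 + 2 * r * cos t) / 2) * sin t ^+ 2)%:E =
   (pi / 2 * (ln 3 - sphere_log_mean (r ^+ 2)))%:E)%E.
Proof.
move=> r0 r1; set g := fun t => (ln 3 - ln (1 + r ^+ 2 + 2 * r * cos t) / 2) * sin t ^+ 2.
have cg : continuous g.
  move=> t; apply: cvgM; last first.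
    apply: (@continuous_comp _ _ _ (@sin R) (fun y => y ^+ 2)).
      exact: continuous_sin.
    exact: exprn_continuous.
  apply: cvgB; first exact: cvg_cst.
  apply: cvgMl; apply: (@continuous_comp _ _ _ (fun t => 1 + r ^+ 2 + 2 * r * cos t) (@ln R)).
    apply: cvgD; first exact: cvg_cst.
    by apply: cvgM; [exact: cvg_cst|exact: continuous_cos].
  exact/continuous_ln/poisson_gt0.
have [P dP] := exists_antiderivative 4 cg.
have dP0 t : 0 <= t <= pi -> is_derive t (1 : R) P (g t).
  move=> /andP[t0 tpi]; apply: dP; rewrite ger0_norm//.
  exact: le_lt_trans tpi pi_lt4.
rewrite (FTC2_is_derive (pi_gt0 R) cg dP0); congr EFin.
have dQ t : 0 <= t <= pi -> is_derive t (1 : R)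
    ((ln 3 \*: (fun t => (t - sin t * cos t) / 2)) - P)
    (ln (1 + r ^+ 2 + 2 * r * cos t) / 2 * sin t ^+ 2).
  move=> tpi; have := is_deriveB (is_deriveZ (ln 3) (is_derive_sin2 t)) (dP0 t tpi).
  by congr is_derive; rewrite /GRing.scale/= /g; ring.
have := log_sin2 r0 r1 dQ.
rewrite -[(_ - P) pi]/(ln 3 * ((pi - sin pi * cos pi) / 2) - P pi).
rewrite -[(_ - P) 0]/(ln 3 * ((0 - sin 0 * cos 0) / 2) - P 0).
rewrite sinpi sin0 !mul0r !subr0 mul0r mulr0 sub0r opprK => e.
by rewrite [RHS]mulrDr mulrN -e; ring.
Qed.

(** Write [sin t ^+ 2 = (1 - cos (2 t)) / 2]: the first half gives [P t / 2], and the second is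
    integrated by parts, where [h1] makes [sin t * cos t * l1] a trigonometric polynomial. The term
    [(t - sin t) / 8] integrates [m1 * sin t ^+ 2]. *)
Lemma is_derive_lower (L P : R -> R) (t l1 m1 : R) :
  is_derive t (1 : R) L l1 -> is_derive t (1 : R) P (L t) ->
  sin t * l1 = - ((1 - cos t) / 2) -> m1 * sin t ^+ 2 = (1 - cos t) / 8 ->
  is_derive t (1 : R) (fun t => ln 3 * ((t - sin t * cos t) / 2) -
     (P t / 2 - (sin t * cos t * L t + sin t / 2 - t / 4 - sin t * cos t / 4) / 2
      + (t - sin t) / 8))
   ((ln 3 - (L t + m1)) * sin t ^+ 2).
Proof.
move=> dL dP h1 h2; apply: is_derive_eq; rewrite /GRing.scale/=.
have e := cos2Dsin2 t.
have eL : L t * sin t ^+ 2 = L t - L t * cos t ^+ 2 by rewrite sin2cos2; ring.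
have h1c : sin t * l1 * cos t = - ((1 - cos t) / 2) * cos t by rewrite h1.
have e3 : ln 3 * sin t ^+ 2 = ln 3 - ln 3 * cos t ^+ 2 :> R by rewrite sin2cos2; ring.
lra.
Qed.

Lemma is_derive_upper (t : R) :
  is_derive t (1 : R) (fun t => ln 3 * ((t - sin t * cos t) / 2) -
     ((t - sin t * cos t) / 4 + sin t ^+ 3 / 6))
   ((ln 3 - (2 + 2 * cos t) / 4) * sin t ^+ 2).
Proof.
apply: is_derive_eq; rewrite /GRing.scale/=.
have e := cos2Dsin2 t.
have e3 : ln 3 * sin t ^+ 2 = ln 3 - ln 3 * cos t ^+ 2 :> R by rewrite sin2cos2; ring.
lra.
Qed.

Lemma outer_integral :
  (\int[mu]_(t in `[0%R, (pi : R)]) ((ln 3 - sphere_log_mean (2 + 2 * cos t)) * sin t ^+ 2)%:E =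
   (pi / 2 * ln 3 - (3 * Num.sqrt 3 / 8 * Lchi3_2 R + pi / 4 - 11 * Num.sqrt 3 / 32))%:E)%E.
Proof.
have cc : continuous (fun t : R => 2 + 2 * cos t).
  move=> t; apply: cvgD; first exact: cvg_cst.
  by apply: cvgM; [exact: cvg_cst|exact: continuous_cos].
set g := fun t => (ln 3 - sphere_log_mean (2 + 2 * cos t)) * sin t ^+ 2.
have cg : continuous g.
  move=> t; apply: cvgM; last first.
    apply: (@continuous_comp _ _ _ (@sin R) (fun y => y ^+ 2)).
      exact: continuous_sin.
    exact: exprn_continuous.
  by apply: cvgB; [exact: cvg_cst|exact: (continuous_sphere_log_mean cc)].
(* Truncation at [1] makes the logarithm continuous on the whole line, as [exists_antiderivative]
   requires; it is inactive on the lower arc. *)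
have cl : continuous (fun t : R => ln (Num.max (2 + 2 * cos t) 1) / 2).
  by move=> t; apply: cvgMl; exact: (continuous_ln_max1 cc).
have [P dP] := exists_antiderivative 4 cg.
have [Pl dPl] := exists_antiderivative 4 cl.
have le4 t : 0 <= t <= pi -> `|t| < 4.
  by move=> /andP[t0 tpi]; rewrite ger0_norm//; exact: le_lt_trans tpi pi_lt4.
rewrite (FTC2_is_derive (pi_gt0 R) cg (fun t tpi => dP t (le4 t tpi))); congr EFin.
have /andP[b0 bpi] := two_pi3_bounds R.
have bI : two_pi3 R \in `[0, pi] by rewrite in_itv/= !ltW.
have lowP t : 0 <= t <= two_pi3 R -> 1 <= 2 + 2 * cos t.
  move=> /andP[t0 tb]; have tI : t \in `[0, pi].
    by rewrite in_itv/= t0 (le_trans tb) ?ltW.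
  have : cos (two_pi3 R) <= cos t by rewrite leNgt ltr_cos// -leNgt.
  by rewrite cos_two_pi3; lra.
have low4 t : 0 <= t <= two_pi3 R -> `|t| < 4.
  by move=> /andP[t0 tb]; apply: le4; rewrite t0 (le_trans tb)// ltW.
have upP t : two_pi3 R <= t <= pi -> 2 + 2 * cos t <= 1.
  move=> /andP[tb tpi]; have tI : t \in `[0, pi].
    by rewrite in_itv/= tpi (le_trans _ tb) ?ltW.
  have : cos t <= cos (two_pi3 R) by rewrite leNgt ltr_cos// -leNgt.
  by rewrite cos_two_pi3; lra.
have dl t : 0 <= t <= two_pi3 R ->
    is_derive t (1 : R) Pl (ln (1 + 1 ^+ 2 + 2 * 1 * cos t) / 2).
  move=> tb; have := dPl t (low4 t tb); congr is_derive.
  rewrite max_l ?lowP//; congr (ln _ / _); ring.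
pose L t := ln (2 + 2 * cos t) / 2 : R.
have lower : P (two_pi3 R) - P 0 = (ln 3 * ((two_pi3 R - sin (two_pi3 R) * cos (two_pi3 R)) / 2) -
     (Pl (two_pi3 R) / 2 - (sin (two_pi3 R) * cos (two_pi3 R) * L (two_pi3 R) + sin (two_pi3 R) / 2 - two_pi3 R / 4
        - sin (two_pi3 R) * cos (two_pi3 R) / 4) / 2
      + (two_pi3 R - sin (two_pi3 R)) / 8)) - (ln 3 * ((0 - sin 0 * cos 0) / 2) -
     (Pl 0 / 2 - (sin 0 * cos 0 * L 0 + sin 0 / 2 - 0 / 4 - sin 0 * cos 0 / 4) / 2
      + (0 - sin 0) / 8)).
  apply: (eq_derive_increment (f1 := g) (g := fun t => ln 3 * ((t - sin t * cos t) / 2) -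
     (Pl t / 2 - (sin t * cos t * L t + sin t / 2 - t / 4 - sin t * cos t / 4) / 2
      + (t - sin t) / 8))); first exact: ltW.
    by move=> t tb; apply: dP; exact: low4.
  move=> t tb; have l1 := lowP t tb.
  have -> : g t = (ln 3 - (L t + (4 * (2 + 2 * cos t))^-1)) * sin t ^+ 2.
    by congr ((_ - _) * _); exact: sphere_log_mean_ge1.
  have c1 : 1 + cos t != 0 by rewrite gt_eqF//; lra.
  have s2 : sin t ^+ 2 = (1 - cos t) * (1 + cos t) by rewrite sin2cos2; ring.
  apply: (is_derive_lower (l1 := - sin t / (2 * (1 + cos t)))).
  - have q0 : 0 < 2 + 2 * cos t by lra.
    have dq : is_derive t (1 : R) (fun t => 2 + 2 * cos t) (- (2 * sin t)).
      by apply: is_derive_eq; rewrite /GRing.scale/=; ring.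
    have := is_deriveZ 2^-1 (@is_derive1_comp R (@ln R) (fun t => 2 + 2 * cos t) t _ _
      (is_derive1_ln q0) dq).
    congr is_derive; first by apply/funext => x; exact: mulrC.
    by rewrite /GRing.scale/=; field; rewrite c1 gt_eqF.
  - have := dl t tb; congr is_derive; rewrite /L; congr (ln _ / _); ring.
  - rewrite mulrA mulrN -expr2 s2; by field.
  - have -> : 4 * (2 + 2 * cos t) = 8 * (1 + cos t) by ring.
    by rewrite s2; field.
have upper : P pi - P (two_pi3 R) = (ln 3 * ((pi - sin pi * cos pi) / 2) -
     ((pi - sin pi * cos pi) / 4 + sin pi ^+ 3 / 6)) -
   (ln 3 * ((two_pi3 R - sin (two_pi3 R) * cos (two_pi3 R)) / 2) -
     ((two_pi3 R - sin (two_pi3 R) * cos (two_pi3 R)) / 4 + sin (two_pi3 R) ^+ 3 / 6)).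
  apply: (eq_derive_increment (f1 := g) (g := fun t => ln 3 * ((t - sin t * cos t) / 2) -
     ((t - sin t * cos t) / 4 + sin t ^+ 3 / 6))); first exact: ltW.
    move=> t /andP[tb tpi]; apply: dP; apply: le4; rewrite tpi andbT.
    by rewrite (le_trans _ tb)// ltW.
  move=> t tb; have -> : g t = (ln 3 - (2 + 2 * cos t) / 4) * sin t ^+ 2.
    by congr ((_ - _) * _); apply: sphere_log_mean_le1; exact: upP.
  exact: is_derive_upper.
have -> : P pi - P 0 = (P pi - P (two_pi3 R)) + (P (two_pi3 R) - P 0) by ring.
rewrite upper lower.
(* The boundary term of the integration by parts vanishes at the crossing because [|1 + x| = 1]
   there, and at [0] because of the sine. *)
have Lb : L (two_pi3 R) = 0.
  by rewrite /L cos_two_pi3 (_ : 2 + 2 * - 2^-1 = 1 :> R) ?ln1 ?mul0r//; lra.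
have hl := log_two_pi3 dl.
rewrite Lb sinpi sin0 cos_two_pi3 sin_two_pi3.
have e3 : Num.sqrt 3 ^+ 2 = 3 :> R by rewrite sqr_sqrtr//; lra.
have e33 : Num.sqrt 3 ^+ 3 = 3 * Num.sqrt 3 :> R by rewrite exprS e3 mulrC.
rewrite exprMn e33.
have -> : Pl (two_pi3 R) = Pl 0 + 3 * Num.sqrt 3 / 4 * Lchi3_2 R by rewrite -hl; ring.
rewrite /two_pi3; move: (@pi R) (Num.sqrt 3 : R) (Lchi3_2 R) (Pl 0) (ln 3 : R) => p q LL p0 l3.
by field.
Qed.

End Definite.

(** * The mean over [y], then over [x], as extended-real integrals *)

Section Assembly.
Context (R : realType).
Notation mu := (@lebesgue_measure R).
Notation mR := (measurableTypeR R).
Notation QR := ((R * R) * (R * R))%type.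
Notation sphere_measure := (sphere_measure R).

(** Passes from the latitude to the polar angle, so that the real part is a cosine. *)
Lemma integral_reflect (g : R -> R) : continuous g ->
  (\int[mu]_(x in `[(- (pi / 2))%R, (pi / 2)%R]) (g (pi / 2 - x)%R)%:E =
   \int[mu]_(x in `[0%R, (pi : R)]) (g x)%:E)%E.
Proof.
move=> cg; have [P dP] := exists_antiderivative 4 cg.
have pi0 := pi_gt0 R; have pi4 := pi_lt4 R.
have dP0 x : 0 <= x <= pi -> is_derive x (1 : R) P (g x).
  by move=> /andP[x0 x1]; apply: dP; rewrite ger0_norm//; exact: le_lt_trans pi4.
have cg' : continuous (fun x => g (pi / 2 - x)).
  move=> x; apply: (@continuous_comp _ _ _ (fun x => pi / 2 - x) g); last exact: cg.
  by apply: cvgB; [exact: cvg_cst|exact: cvg_id].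
have piN : - (pi / 2) < pi / 2 :> R by lra.
have dN x : - (pi / 2) <= x <= pi / 2 ->
    is_derive x (1 : R) (fun x => - P (pi / 2 - x)) (g (pi / 2 - x)).
  move=> /andP[x0 x1].
  have d1 : is_derive (pi / 2 - x) (1 : R) P (g (pi / 2 - x)).
    by apply: dP0; apply/andP; split; lra.
  have d2 : is_derive x (1 : R) (fun x => pi / 2 - x) (- 1).
    by have := is_deriveB (is_derive_cst (pi / 2 : R) x (1 : R)) (is_derive_id x (1 : R)); rewrite sub0r.
  have := is_deriveN (@is_derive1_comp R P (fun x => pi / 2 - x) x _ _ d1 d2).
  by rewrite mulrN1 opprK.
rewrite (FTC2_is_derive piN cg' dN) (FTC2_is_derive pi0 cg dP0).
have -> : pi / 2 - pi / 2 = 0 :> R by rewrite subrr.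
have -> : pi / 2 - - (pi / 2) = pi :> R by lra.
by congr EFin; ring.
Qed.

Lemma sin_pihalfB (x : R) : sin (pi / 2 - x) = cos x.
Proof. by rewrite sinB sin_pihalf cos_pihalf mul1r mul0r subr0. Qed.

Lemma cos_pihalfB (x : R) : cos (pi / 2 - x) = sin x.
Proof. by rewrite cosB sin_pihalf cos_pihalf mul1r mul0r add0r. Qed.

Lemma integral_sphere_cos (a : quat R) (G : R -> \bar R) (h : R -> R) (t0 : R) :
  0 <= a.1.1 -> measurable_fun setT G -> (forall x, 0 <= G x)%E ->
  continuous h -> (forall x, 0 <= h x) ->
  (forall x, 0 < x < pi -> x != t0 -> G (qnorm a * cos x) = (h x)%:E) ->
  (\int[sphere_measure]_y G (qdot a y) =
   (2 / pi)%:E * \int[mu]_(x in `[0%R, (pi : R)]) (h x * sin x ^+ 2)%:E)%E.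
Proof.
move=> a0 mG G0 ch h0 hG.
have pi0 := pi_gt0 R.
have ch' : continuous (fun x => h (pi / 2 - x)).
  move=> x; apply: (@continuous_comp _ _ _ (fun x => pi / 2 - x) h); last exact: ch.
  by apply: cvgB; [exact: cvg_cst|exact: cvg_id].
have cg : continuous (fun x => h x * sin x ^+ 2).
  move=> x; apply: cvgM; first exact: ch.
  apply: (@continuous_comp _ _ _ (@sin R) (fun y => y ^+ 2)).
    exact: continuous_sin.
  exact: exprn_continuous.
rewrite (integral_sphere (t0 := pi / 2 - t0) a0 mG G0 ch').
- rewrite -(integral_reflect cg); congr (_ * _)%E.
  by apply: eq_integral => x _; rewrite sin_pihalfB.
- by move=> x; exact: h0.
- move=> x /andP[x0 x1] xt; rewrite -cos_pihalfB hG//.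
    by apply/andP; split; lra.
  by apply: contra_neq xt => <-; rewrite subKr.
Qed.

(** The argument is a squared modulus. The cutoff at [9] makes the function nonnegative on the whole
    line, as Tonelli needs; the value [+oo] at [0] encodes [log 0 = -oo]. *)
Definition log_deficit (t : R) : \bar R :=
  if t <= 0 then +oo%E else if 9 <= t then 0%E else (ln 3 - ln t / 2)%:E.

Lemma ln9 : ln 9 = 2 * ln 3 :> R.
Proof.
have -> : 9 = 3 ^+ 2 :> R by rewrite expr2; lra.
by rewrite lnXn// mulr2n; lra.
Qed.

Lemma log_deficit_ge0 t : (0 <= log_deficit t)%E.
Proof.
rewrite /log_deficit; case: ifPn => // t0; case: ifPn => // t9.
rewrite -!ltNge in t0 t9; rewrite lee_fin.
have : ln t <= ln 9 by rewrite ler_ln ?posrE// ltW.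
by rewrite ln9; lra.
Qed.

Lemma measurable_log_deficit : measurable_fun setT log_deficit.
Proof.
apply: measurable_fun_ifT => //; first exact: measurable_fun_ler.
apply: measurable_fun_ifT => //; first exact: measurable_fun_ler.
apply/measurable_EFinP; apply: measurable_funB => //.
by apply: measurable_funM => //; exact: measurable_ln.
Qed.

Lemma log_deficitE t : 0 < t <= 9 -> log_deficit t = (ln 3 - ln t / 2)%:E.
Proof.
move=> /andP[t0 t9]; rewrite /log_deficit leNgt t0/=; case: ifPn => // t9'.
have -> : t = 9 by apply/eqP; rewrite eq_le t9.
by rewrite ln9; congr EFin; lra.
Qed.

Lemma logabsE (w : quat R) : qdot w w <= 9 ->
  logabs w = ((ln 3)%:E - log_deficit (qdot w w))%E.
Proof.
move=> w9; have w0 : 0 <= qdot w w by rewrite /qdot -!expr2 !addr_ge0// sqr_ge0.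
rewrite /logabs qnormE sqrtr_eq0 /log_deficit; case: ifPn => // wn.
have {}w0 : 0 < qdot w w by rewrite ltNge.
have -> : ln (Num.sqrt (qdot w w)) = ln (qdot w w) / 2.
  rewrite -[in RHS](sqr_sqrtr (ltW w0)) lnXn ?sqrtr_gt0// mulr2n; by field.
case: ifPn => w9'.
  have -> : qdot w w = 9 by apply/eqP; rewrite eq_le w9.
  by rewrite ln9 sube0; congr EFin; lra.
by rewrite -EFinB; congr EFin; lra.
Qed.

(* [2 + 2 t] is the squared modulus of [1 + x] for a unit [x] with real part [t]. *)
Definition inner_deficit (t : R) : \bar R :=
  ((2 / pi)%:E * \int[mu]_v (((hypot1 v ^+ 4)^-1)%:E *
     log_deficit (1 + (2 + 2 * t) + 2 * (Num.sqrt (2 + 2 * t) * (v / hypot1 v)))%R))%E.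

Lemma measurable_log_deficit_shift (q : R) : measurable_fun setT (fun s : R => log_deficit (1 + q + 2 * s)).
Proof.
by apply: (measurableT_comp measurable_log_deficit); apply: measurable_funD.
Qed.

Lemma inner_deficitE (a : quat R) t : 0 <= a.1.1 -> qdot a a = 2 + 2 * t ->
  (\int[sphere_measure]_y log_deficit (1 + (2 + 2 * t) + 2 * qdot a y)%R = inner_deficit t)%E.
Proof.
move=> a0 aa.
rewrite (integral_sphere_v (G := fun s => log_deficit (1 + (2 + 2 * t) + 2 * s)) a0).
- by rewrite /inner_deficit qnormE aa.
- exact: measurable_log_deficit_shift.
- by move=> s; exact: log_deficit_ge0.
Qed.

Lemma inner_deficit_ge0 t : (0 <= inner_deficit t)%E.
Proof.
apply: mule_ge0; first by rewrite lee_fin divr_ge0// pi_ge0.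
apply: integral_ge0 => v _; apply: mule_ge0; last exact: log_deficit_ge0.
by rewrite lee_fin invr_ge0 exprn_ge0// ltW// hypot1_gt0.
Qed.

(** Here the explicit form of [inner_deficit] pays off: its integrand is jointly measurable in [t]
    and [v], so Tonelli gives measurability in [t]. *)
Lemma measurable_inner_deficit : measurable_fun setT (inner_deficit : mR -> \bar R).
Proof.
pose F (p : mR * mR) : \bar R := (((hypot1 p.2 ^+ 4)^-1)%:E *
  log_deficit (1 + (2 + 2 * p.1) + 2 * (Num.sqrt (2 + 2 * p.1) * (p.2 / hypot1 p.2)))%R)%E.
have mk : measurable_fun setT (fun p : mR * mR => hypot1 p.2 : mR).
  by apply: (measurableT_comp (@measurable_hypot1 R)).
have mi (f : mR * mR -> mR) : measurable_fun setT f -> measurable_fun setT (fun p => (f p)^-1 : mR).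
  by move=> mf; apply: (measurableT_comp (@measurable_invr R) mf).
have mt : measurable_fun setT (fun p : mR * mR => 2 + 2 * p.1 : mR).
  by apply: measurable_funD => //; exact: measurable_funM.
have mF : measurable_fun setT F.
  apply: emeasurable_funM.
    by apply/measurable_EFinP; apply: mi; exact: measurable_funX.
  apply: (measurableT_comp measurable_log_deficit); apply: measurable_funD.
    exact: measurable_funD.
  apply: measurable_funM => //; apply: measurable_funM.
    exact: (measurableT_comp (continuous_measurable_fun (@sqrt_continuous R)) mt).
  by apply: measurable_funM => //; exact: mi.
have F0 p : (0 <= F p)%E.
  apply: mule_ge0; last exact: log_deficit_ge0.
  by rewrite lee_fin invr_ge0 exprn_ge0// ltW// hypot1_gt0.
have m1 := measurable_fun_fubini_tonelli_F (m2 := mu) F mF F0.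
exact: (emeasurable_funM (measurable_cst _) m1).
Qed.

Lemma inner_deficit_cos (x : R) : 0 < x < pi -> x != two_pi3 R ->
  inner_deficit (cos x) = (ln 3 - sphere_log_mean (2 + 2 * cos x))%:E.
Proof.
move=> /andP[x0 xpi] xb.
have c1 : -1 <= cos x <= 1 by rewrite cos_geN1 cos_le1.
have /andP[cN c11] := c1.
pose r := Num.sqrt (2 + 2 * cos x).
have r0 : 0 <= r by exact: sqrtr_ge0.
have r2 : r ^+ 2 = 2 + 2 * cos x by rewrite sqr_sqrtr//; lra.
(* The excluded angle is exactly the one with modulus [1], where the inner logarithm is singular. *)
have r_1 : r != 1.
  apply: contra_neq xb => r1.
  have bI : two_pi3 R \in `[0, pi] by have /andP[? ?] := two_pi3_bounds R; rewrite in_itv/= !ltW.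
  apply: cos_inj => //; first by rewrite in_itv/= !ltW.
  by rewrite cos_two_pi3; rewrite r1 expr1n in r2; lra.
have r_le2 : r <= 2.
  by rewrite -(@ler_pXn2r _ 2) ?nnegrE// r2 expr2; lra.
(* By [inner_deficitE] only the modulus matters, so a real representative may replace [1 + x]. *)
pose a : quat R := ((r, 0), (0, 0)).
have aa : qdot a a = 2 + 2 * cos x by rewrite /qdot/= !mulr0 !addr0 -expr2 r2.
have na : qnorm a = r by rewrite qnormE aa.
rewrite -(@inner_deficitE a)//.
have D0 t : 0 < 1 + r ^+ 2 + 2 * r * cos t by exact: poisson_gt0.
have D9 t : 1 + r ^+ 2 + 2 * r * cos t <= 9.
  by have := cos_le1 t => ct; nra.
rewrite (@integral_sphere_cos a (fun s => log_deficit (1 + (2 + 2 * cos x) + 2 * s))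
  (fun t => ln 3 - ln (1 + r ^+ 2 + 2 * r * cos t) / 2) 0)//.
- rewrite inner_integral// -EFinM r2; congr EFin.
  rewrite mulrA mulrA divfK ?gt_eqF ?pi_gt0// mulfV ?mul1r//.
- exact: measurable_log_deficit_shift.
- by move=> s; exact: log_deficit_ge0.
- move=> t; apply: cvgB; first exact: cvg_cst.
  apply: cvgMl; apply: (@continuous_comp _ _ _ (fun t => 1 + r ^+ 2 + 2 * r * cos t) (@ln R)).
    apply: cvgD; first exact: cvg_cst.
    by apply: cvgM; [exact: cvg_cst|exact: continuous_cos].
  exact: continuous_ln.
- move=> t; have : ln (1 + r ^+ 2 + 2 * r * cos t) <= ln 9.
    by rewrite ler_ln ?posrE.
  by rewrite ln9; lra.
- move=> t _ _; rewrite na -r2 mulrA log_deficitE//.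
  by rewrite D0 D9.
Qed.

(** A second use of the sphere formula, with [a = 1], for which [qdot a x] is the real part of
    [x]. *)
Lemma integral_inner_deficit :
  (\int[sphere_measure]_x inner_deficit x.1.1 =
   (ln 3 - 2 / pi * (3 * Num.sqrt 3 / 8 * Lchi3_2 R + pi / 4 - 11 * Num.sqrt 3 / 32))%:E)%E.
Proof.
pose a : quat R := qone R.
have na : qnorm a = 1 by rewrite /qnorm/= !expr0n/= !addr0 expr1n sqrtr1.
have -> : (\int[sphere_measure]_x inner_deficit x.1.1 = \int[sphere_measure]_x inner_deficit (qdot a x))%E.
  by apply: eq_integral => x _; rewrite /qdot/= mul1r !mul0r !addr0.
rewrite (@integral_sphere_cos a inner_deficit (fun t => ln 3 - sphere_log_mean (2 + 2 * cos t)) (two_pi3 R)).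
- rewrite outer_integral -EFinM; congr EFin.
  have p0 : (pi : R) != 0 by rewrite gt_eqF// pi_gt0.
  by move: (pi : R) p0 (Num.sqrt 3 : R) (Lchi3_2 R) (ln 3 : R) => p p0 s l l3; field.
- exact: ler01.
- exact: measurable_inner_deficit.
- exact: inner_deficit_ge0.
- move=> t; apply: cvgB; first exact: cvg_cst.
  have cc : continuous (fun t : R => 2 + 2 * cos t).
    move=> u; apply: cvgD; first exact: cvg_cst.
    by apply: cvgM; [exact: cvg_cst|exact: continuous_cos].
  exact: (continuous_sphere_log_mean cc).
- by move=> t; rewrite subr_ge0; apply: sphere_log_mean_le; have := cos_le1 t; lra.
- by move=> t tpi tb; rewrite na mul1r; exact: inner_deficit_cos.
Qed.

End Assembly.

(** * Integration over the torus and conclusion *)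

Section Mahler.
Context (R : realType).
Notation mu := (@lebesgue_measure R).
Notation mR := (measurableTypeR R).
Notation QR := ((R * R) * (R * R))%type.
Notation sphere_measure := (sphere_measure R).

Lemma measurable_qdot_self : measurable_fun setT ((fun u => qdot u u) : QR -> R).
Proof.
by repeat apply: measurable_funD; apply: measurable_funM; exact: measurableT_comp.
Qed.

Lemma measurable_S3 : measurable (@S3 R : set QR).
Proof.
rewrite (_ : @S3 R = @qnorm R @^-1` [set 1])//.
have m : measurable_fun setT (@qnorm R : QR -> mR) by exact: measurable_qnorm.
by rewrite -[X in measurable X]setTI; exact: m.
Qed.

(** Directions of nonzero points are unit vectors, so the preimage is empty. Identities valid only
    on the sphere can therefore be used under integrals over the whole space. *)
Lemma sphere_measure_S3C : sphere_measure (~` @S3 R) = 0%E.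
Proof.
rewrite -[LHS]/(cone_measure R (~` @S3 R)) cone_measureE.
have -> : @qdir R @^-1` (~` @S3 R) `&` @punctured_ball R = set0.
  apply/seteqP; split => // u [/= h /andP[u0 _]]; apply: h.
  exact: qnorm_qdir.
by rewrite measure0 mule0.
Qed.

Lemma sphere_measure_setT : sphere_measure setT = 1%E.
Proof.
have -> : (sphere_measure setT = \int[sphere_measure]_y (cst 1%E (qdot (qone R) y)))%E.
  by rewrite integral_cst// mul1e.
rewrite (@integral_sphere_v R (qone R) (cst 1%E))//=.
under eq_integral do rewrite mule1.
rewrite integral_hypot1_pow4 -EFinM; congr EFin.
by rewrite mulrA divfK ?gt_eqF ?pi_gt0// mulfV// pnatr_eq0.
Qed.

Lemma sphere_measure_S3 : sphere_measure (@S3 R) = 1%E.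
Proof.
rewrite -sphere_measure_setT -(setUv (@S3 R)) measureU0//.
- exact: measurable_S3.
- exact: measurableC measurable_S3.
- exact: sphere_measure_S3C.
Qed.

Lemma sphere_measure_ae (f g : QR -> \bar R) : measurable_fun setT f -> measurable_fun setT g ->
  (forall x, 0 <= f x)%E -> (forall x, 0 <= g x)%E ->
  (forall x, S3 x -> f x = g x) -> (\int[sphere_measure]_x f x = \int[sphere_measure]_x g x)%E.
Proof.
move=> mf mg f0 g0 fg; apply: ge0_ae_eq_integral => //.
exists (~` @S3 R); split; [exact: measurableC measurable_S3|exact: sphere_measure_S3C|].
by move=> x /=; apply: contra_not => xS _; exact: fg.
Qed.

Definition unit_torus : set (QR * QR) := [set z | S3 z.1 /\ S3 z.2].

Definition sqmod (z : QR * QR) : R :=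
  let w := qadd (qadd (qone R) z.1) z.2 in qdot w w.

Lemma measurable_qadd d (T : measurableType d) (f g : T -> QR) :
  measurable_fun setT f -> measurable_fun setT g ->
  measurable_fun setT ((fun z => qadd (f z) (g z)) : T -> QR).
Proof.
move=> mf mg.
have mc (p : QR -> R) : measurable_fun setT p ->
    measurable_fun setT (fun z => p (f z) + p (g z)).
  by move=> mp; apply: measurable_funD; exact: measurableT_comp.
apply: measurable_fun_pair; apply: measurable_fun_pair.
- by apply: (mc (fun u => u.1.1)); exact: measurableT_comp.
- by apply: (mc (fun u => u.1.2)); exact: measurableT_comp.
- by apply: (mc (fun u => u.2.1)); exact: measurableT_comp.
- by apply: (mc (fun u => u.2.2)); exact: measurableT_comp.
Qed.

Lemma measurable_sqmod : measurable_fun setT sqmod.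
Proof.
apply: (measurableT_comp measurable_qdot_self).
by do 2 apply: measurable_qadd => //.
Qed.

Lemma S3E (x : quat R) : S3 x -> qdot x x = 1.
Proof.
rewrite /S3/= qnormE => h.
by rewrite -[LHS]sqr_sqrtr ?h ?expr1n// /qdot -!expr2 !addr_ge0// sqr_ge0.
Qed.

Lemma S3_re (x : quat R) : S3 x -> -1 <= x.1.1 <= 1.
Proof.
move=> /S3E; rewrite /qdot -!expr2 => h.
have := sqr_ge0 x.1.2; have := sqr_ge0 x.2.1; have := sqr_ge0 x.2.2 => *.
rewrite -ler_norml -(@ler_pXn2r _ 2) ?nnegrE// expr1n real_normK ?num_real//; lra.
Qed.

Lemma sqmodE (x y : quat R) : S3 y ->
  sqmod (x, y) = 1 + qdot (qadd (qone R) x) (qadd (qone R) x) + 2 * qdot (qadd (qone R) x) y.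
Proof.
move=> /S3E h; set a := qadd _ x.
transitivity (qdot y y + qdot a a + 2 * qdot a y); last by rewrite h.
by rewrite /sqmod -/a /qdot/=; ring.
Qed.

Lemma qdot_one_add (x : quat R) : S3 x ->
  qdot (qadd (qone R) x) (qadd (qone R) x) = 2 + 2 * x.1.1.
Proof.
move=> /S3E h; transitivity (1 + 2 * x.1.1 + qdot x x); last by rewrite h; ring.
by rewrite /qdot/=; ring.
Qed.

Lemma sqmod_le9 (x y : quat R) : S3 x -> S3 y -> sqmod (x, y) <= 9.
Proof.
move=> xS yS; rewrite sqmodE// qdot_one_add//.
have /andP[_ x1] := S3_re xS; have /andP[_ y1] := S3_re yS.
have := S3E xS; have := S3E yS; rewrite /qdot/= => ey ex.
(* The squared coordinates of [x - y] add up to [2 - 2 * qdot x y], which bounds the last term of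
   [3 + 2 * x.1.1 + 2 * y.1.1 + 2 * qdot x y]. *)
have := sqr_ge0 (x.1.1 - y.1.1); have := sqr_ge0 (x.1.2 - y.1.2).
have := sqr_ge0 (x.2.1 - y.2.1); have := sqr_ge0 (x.2.2 - y.2.2).
by move=> *; nra.
Qed.

Notation m2 := (sigma_finite_prod sphere_measure sphere_measure).

Lemma measurable_unit_torus : measurable unit_torus.
Proof.
rewrite (_ : unit_torus = @S3 R `*` @S3 R)//.
by apply: measurableX; exact: measurable_S3.
Qed.

Lemma m2_unit_torus : m2 unit_torus = 1%E.
Proof.
rewrite -[LHS]/((sphere_measure \x sphere_measure)%E (@S3 R `*` @S3 R)).
rewrite (product_measure1E _ _ measurable_S3 measurable_S3) sphere_measure_S3 mule1.
exact: sphere_measure_S3.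
Qed.

Lemma m2_setT : m2 setT = 1%E.
Proof.
rewrite -[LHS]/((sphere_measure \x sphere_measure)%E setT) -setXTT.
rewrite (product_measure1E _ _ measurableT measurableT) sphere_measure_setT mule1.
exact: sphere_measure_setT.
Qed.

Lemma m2_unit_torusC : m2 (~` unit_torus) = 0%E.
Proof.
have h : (m2 setT = m2 unit_torus + m2 (~` unit_torus))%E.
  apply: etrans (congr1 m2 (esym (setUv unit_torus))) _.
  exact: measureU measurable_unit_torus (measurableC measurable_unit_torus) (setICr unit_torus).
rewrite m2_setT m2_unit_torus in h; have := measure_ge0 m2 (~` unit_torus).
case: (m2 (~` unit_torus)) h => [r| |]// [h] _; congr EFin; lra.
Qed.

Lemma measurable_log_deficit_sqmod : measurable_fun setT (@log_deficit R \o sqmod).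
Proof. exact: (measurableT_comp (@measurable_log_deficit R) measurable_sqmod). Qed.

Lemma integral_log_deficit_sqmod :
  (\int[m2]_(z in unit_torus) log_deficit (sqmod z) =
   (ln 3 - 2 / pi * (3 * Num.sqrt 3 / 8 * Lchi3_2 R + pi / 4 - 11 * Num.sqrt 3 / 32))%:E)%E.
Proof.
have mH := measurable_log_deficit_sqmod.
have H0 z : (0 <= (@log_deficit R \o sqmod) z)%E by exact: log_deficit_ge0.
have -> : (\int[m2]_(z in unit_torus) log_deficit (sqmod z) = \int[m2]_z (@log_deficit R \o sqmod) z)%E.
  rewrite [RHS](@ge0_negligible_integral _ _ _ m2 setT (~` unit_torus))//.
  - by rewrite setTD setCK.
  - exact: measurableC measurable_unit_torus.
  - exact: m2_unit_torusC.
rewrite (tonelli1 _ mH H0) -integral_inner_deficit.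
have mG : measurable_fun setT (fun x : QR => inner_deficit x.1.1).
  have mG' : measurable_fun setT (@inner_deficit R : R -> _) by exact: measurable_inner_deficit.
  by apply: (measurableT_comp mG'); exact: measurableT_comp.
apply: sphere_measure_ae => //.
- exact: (measurable_fun_fubini_tonelli_F (m2 := sphere_measure) _ mH H0).
- by move=> x; exact: integral_ge0.
- by move=> x; exact: inner_deficit_ge0.
- move=> x xS; have /andP[x1 _] := S3_re xS.
  (* On the sphere [1 + x] has nonnegative real part, the sign condition under which the rotation is
     available. *)
  rewrite -(@inner_deficitE _ (qadd (qone R) x)); last 2 first.
  + by rewrite /=; lra.
  + exact: qdot_one_add.
  apply: sphere_measure_ae.
  + have mx : measurable_fun setT (fun y : QR => (x, y)) by exact: measurable_fun_pair.
    exact: (measurableT_comp mH mx).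
  + exact: (measurableT_comp (measurable_log_deficit_shift _) (measurable_qdot _)).
  + by move=> y; exact: log_deficit_ge0.
  + by move=> y; exact: log_deficit_ge0.
  + by move=> y yS /=; rewrite sqmodE// qdot_one_add.
Qed.

End Mahler.

Theorem theorem1p5 (R : realType) :
  mH (fun x y : quat R => qadd (qadd (qone R) x) y) =
  (2^-1 - 11%:R * Num.sqrt 3%:R / (16%:R * pi)
   + 3%:R * Num.sqrt 3%:R / (4%:R * pi) * Lchi3_2 R)%:E.
Proof.
rewrite /mH muT2E.
transitivity (\int[sigma_finite_prod (sphere_measure R) (sphere_measure R)]_(z in unit_torus (R := R))
    ((ln 3)%:E - log_deficit (sqmod z)))%E.
  apply: eq_integral => z; rewrite inE => -[z1 z2].
  by apply: logabsE; case: z z1 z2 => x y /=; exact: sqmod_le9.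
have J := integral_log_deficit_sqmod R.
have mT := @measurable_unit_torus R.
have mH2 : measurable_fun (unit_torus (R := R)) (@log_deficit R \o @sqmod R).
  by apply: measurable_funTS; exact: measurable_log_deficit_sqmod.
(* The finite value in [J] makes the deficit integrable, so the difference may be split although its
   integrand reaches [-oo]. *)
have iH : (sigma_finite_prod (sphere_measure R) (sphere_measure R)).-integrable (unit_torus (R := R)) (@log_deficit R \o @sqmod R).
  apply/integrableP; split => //.
  under eq_integral do rewrite gee0_abs ?log_deficit_ge0//.
  by rewrite J ltry.
have ic : (sigma_finite_prod (sphere_measure R) (sphere_measure R)).-integrable (unit_torus (R := R)) (cst (ln 3)%:E).
  apply/integrableP; split => //.
  rewrite integral_cst// [X in (_ * X)%E](_ : _ = 1%E); last exact: m2_unit_torus.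
  by rewrite mule1 ltry.
rewrite (integralB mT ic iH) J integral_cst//.
rewrite [X in (_ * X - _)%E](_ : _ = 1%E); last exact: m2_unit_torus.
rewrite mule1 -EFinB; congr EFin.
have p0 : (pi : R) != 0 by rewrite gt_eqF// pi_gt0.
move: (pi : R) p0 (Num.sqrt 3%:R : R) (Lchi3_2 R) (ln 3 : R) => p p0 s l l3.
by field.
Qed.
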